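(* Let $\Phi$ be a reduced irreducible root system of rank $\ge 2$, let $R$ be a commutative ring with $1$, and let $A,B$ be two ideals of $R$. Assume: ( * ) in the cases $\Phi=\mathrm{C}_2,\mathrm{G}_2$ the ring $R$ does not have residue fields of two elements, and in the case $\Phi=\mathrm{C}_l$, $l\ge 2$, additionally any $c\in R$ is contained in the ideal $c^2R+2cR$. Then for any $\alpha\in\Phi$, all $a\in A$, $b\in B$, and any $x\in E(\Phi,R)$ one has $${}^{x}y_{\alpha}(a,b)\equiv y_{\alpha}(a,b)\pmod{E(\Phi,R,AB)}.$$
   Context: $G(\Phi,R)$ is a Chevalley group of type $\Phi$ over $R$ with a fixed split maximal torus, and $x_{\alpha}(\xi)$, $\alpha\in\Phi$, $\xi\in R$, are the corresponding elementary root unipotents (parametrised in the usual way via a Chevalley basis). The absolute elementary subgroup is $E(\Phi,R)=\langle x_\alpha(\xi)\mid \alpha\in\Phi,\ \xi\in R\rangle$. For an ideal $I$ of $R$, $E(\Phi,I)=\langle x_\alpha(\xi)\mid\alpha\in\Phi,\ \xi\in I\rangle$, and the relative elementary subgroup $E(\Phi,R,I)$ is the normal closure of $E(\Phi,I)$ in $E(\Phi,R)$. $AB$ is the product ideal. Commutators are $[x,y]=xyx^{-1}y^{-1}$, and ${}^xy=xyx^{-1}$. The elementary commutators are $y_{\alpha}(a,b)=[x_{\alpha}(a),x_{-\alpha}(b)]$. For $g,h\in E(\Phi,R)$, $g\equiv h\pmod{E(\Phi,R,AB)}$ means that $g$ and $h$ have the same class modulo the normal subgroup $E(\Phi,R,AB)$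 of $E(\Phi,R)$. $\mathrm{B}_2$ and $\mathrm{C}_2$ denote the same root system. *)

(* Defs.v *)
From HB Require Import structures.
From mathcomp Require Import all_boot all_order all_fingroup all_algebra.

Set Implicit Arguments.
Unset Strict Implicit.
Unset Printing Implicit Defensive.

Import Order.TTheory GRing.Theory Num.Theory.

Local Open Scope ring_scope.

(** * Root systems in the Euclidean space F^l *)

Section RootSystems.
Variable F : rcfType.

Definition dot l (u v : 'rV[F]_l) : F := \sum_i u 0 i * v 0 i.

(* <u, v^vee>, linear in u only *)
Definition pairing l (u v : 'rV[F]_l) : F := 2 * dot u v / dot v v.

Record root_system l (Phi : seq 'rV[F]_l) : Prop := RootSystem {
  root_neq0 : 0 \notin Phi;
  root_span : <<Phi>>%VS = fullv;
  root_reflection : forall a b, a \in Phi -> b \in Phi ->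
    b - pairing b a *: a \in Phi;
  root_integral : forall a b, a \in Phi -> b \in Phi ->
    exists k : int, pairing b a = k%:~R }.

Definition reduced l (Phi : seq 'rV[F]_l) : Prop :=
  forall a c, a \in Phi -> c *: a \in Phi -> c = 1 \/ c = -1.

Definition irreducible l (Phi : seq 'rV[F]_l) : Prop :=
  forall P : {pred 'rV[F]_l},
    (forall a b, a \in Phi -> b \in Phi -> a \in P -> b \notin P ->
       dot a b = 0) ->
    {in Phi, forall a, a \in P} \/ {in Phi, forall a, a \notin P}.

(* Psi may span a proper subspace of F^k, as the usual model of G_2 does. *)
Definition root_iso l k (Phi : seq 'rV[F]_l) (Psi : 'rV[F]_k -> Prop) : Prop :=
  exists f : 'M[F]_(l, k),
    [/\ row_free f,
        forall b, Psi b <-> exists2 a, a \in Phi & b = a *m f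
      & {in Phi &, forall a b, pairing (a *m f) (b *m f) = pairing a b}].

Definition eps l (i : 'I_l) : 'rV[F]_l := delta_mx 0 i.

Definition C_roots l (v : 'rV[F]_l) : Prop :=
  (exists i j (s t : bool), i != j /\
     v = (-1) ^+ s *: eps i + (-1) ^+ t *: eps j) \/
  (exists i (s : bool), v = (-1) ^+ s *: (2 *: eps i)).

Definition G2_roots (v : 'rV[F]_3) : Prop :=
  (exists i j, i != j /\ v = eps i - eps j) \/
  (exists i j k (s : bool), uniq [:: i; j; k] /\
     v = (-1) ^+ s *: (2 *: eps i - eps j - eps k)).

Definition type_C l (Phi : seq 'rV[F]_l) : Prop := root_iso Phi (@C_roots l).
Definition type_C2 l (Phi : seq 'rV[F]_l) : Prop := root_iso Phi (@C_roots 2).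
Definition type_G2 l (Phi : seq 'rV[F]_l) : Prop := root_iso Phi G2_roots.

(* b - p a is the last root of the a-string through b in the direction -a *)
Definition string_start l (Phi : seq 'rV[F]_l) (a b : 'rV[F]_l) (p : nat) :=
  b - a *+ p \in Phi /\ forall k, (p < k)%N -> b - a *+ k \notin Phi.

End RootSystems.

(** * Chevalley bases acting on an admissible lattice *)

Definition lie (S : pzRingType) (x y : S) : S := x * y - y * x.

(* The entrywise quotient X^m / m!; only meaningful when m! divides X^m. *)
Definition divpow n (X : 'M[int]_n) (m : nat) : 'M[int]_n :=
  map_mx (fun k => (k %/ m`!)%Z) (X ^+ m).

(* e sends each root to the matrix by which the root vector e_a of a Chevalley
   basis acts on an admissible lattice Z^n in a finite-dimensional faithful
   module; the coroot h_a acts by [e_a, e_{-a}].  For Phi irreducible, e_a != 0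
   says that the module is faithful.  Every lattice between the root lattice
   and the weight lattice occurs as the lattice of weights of such a module, so
   Chevalley groups of all isogeny classes are covered.  The values of e outside
   Phi are irrelevant.  The Chevalley group G(Phi, R) is a subgroup of GL_n(R)
   through such a module; only its elementary subgroup is needed here. *)
Record chevalley_module (F : rcfType) l (Phi : seq 'rV[F]_l) n
    (e : 'rV[F]_l -> 'M[int]_n) : Prop := ChevalleyModule {
  chev_neq0 : {in Phi, forall a, e a != 0};
  chev_cartan : forall a b (k : int), a \in Phi -> b \in Phi ->
    pairing b a = k%:~R ->
    lie (lie (e a) (e (- a))) (e b) = k *: e b;
  chev_root : forall a b p, a \in Phi -> b \in Phi -> a + b \in Phi ->
    string_start Phi a b p ->
    lie (e a) (e b) = (p.+1)%:Z *: e (a + b) \/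
    lie (e a) (e b) = - (p.+1)%:Z *: e (a + b);
  chev_nonroot : forall a b, a \in Phi -> b \in Phi -> a + b \notin Phi ->
    a + b != 0 -> lie (e a) (e b) = 0;
  chev_admissible : forall a (m : nat), a \in Phi ->
    forall i j, (m`! %| (e a ^+ m) i j)%Z }.

(* exp(xi X) over R, in divided powers; the sum stops at n because root vectors
   satisfy X ^+ n = 0: see chev_nilpotent. *)
Definition expmx (R : comPzRingType) n (X : 'M[int]_n) (xi : R) : 'M[R]_n :=
  \sum_(m < n) xi ^+ m *: map_mx intr (divpow X m).

(** * Root elements are exponentials *)

Lemma lie_power_shift (S : pzRingType) (h x : S) (m : nat) :
  lie h x = x *+ 2 -> lie h (x ^+ m) = x ^+ m *+ (2 * m).
Proof.
move=> hx; elim: m => [|m IH].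
  by rewrite muln0 mulr0n /lie expr0 mulr1 mul1r subrr.
have -> : lie h (x ^+ m.+1) = lie h (x ^+ m) * x + x ^+ m * lie h x.
  rewrite /lie exprSr mulrBl mulrBr !mulrA.
  by rewrite addrA addrNK.
by rewrite IH hx mulrnAr mulrnAl -exprSr -mulrnDr mulnS addnC.
Qed.

Lemma nilpotent_of_lie n (h x : 'M[int]_n) : lie h x = 2 *: x -> x ^+ n = 0.
Proof.
case: n h x => [|n] h x hx; first by rewrite [LHS]thinmx0 [RHS]thinmx0.
have injZQ : injective (intr : int -> rat) by exact: intr_inj.
suff: (map_mx intr x : 'M[rat]_n.+1) ^+ n.+1 = 0.
  rewrite -rmorphXn /= => /matrixP Xn0; apply/matrixP => i j.
  by have := Xn0 i j; rewrite !mxE => /eqP; rewrite intr_eq0 => /eqP.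
set X : 'M[rat]_n.+1 := map_mx intr x; set H : 'M[rat]_n.+1 := map_mx intr h.
have HX : lie H X = X *+ 2.
  rewrite /lie -!rmorphM -rmorphB /= -/(lie h x) hx.
  by rewrite -scaler_nat map_mxZ.
have [K XK] : exists K, X ^+ K = 0.
  pose A := lin_mx (mulmx H) - lin_mx (mulmxr H) : 'M[rat]_(n.+1 * n.+1).
  have XA k : mxvec (X ^+ k) *m A = (2 * k)%:R *: mxvec (X ^+ k).
    rewrite mulmxBr !mul_vec_lin /= -linearB /=.
    have := lie_power_shift k HX; rewrite /lie => ->.
    by rewrite -scaler_nat linearZ.
  pose N := (n.+1 * n.+1)%N.
  have [/existsP[k /eqP Xk]|/existsPn Xn0] :=
    boolP [exists k : 'I_N.+1, X ^+ k == 0].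
    by exists k.
  have := @max_poly_roots _ (char_poly A) [seq (2 * k)%:R | k <- iota 0 N.+1].
  rewrite size_map size_iota size_char_poly ltnn => contra.
  exfalso; suff: false by []; apply: contra.
  - by rewrite -size_poly_eq0 size_char_poly.
  - apply/allP => y /mapP[k]; rewrite mem_iota add0n => /= kN ->.
    rewrite -eigenvalue_root_char; apply/eigenvalueP; exists (mxvec (X ^+ k)).
      exact: XA.
    by rewrite mxvec_eq0; exact: (Xn0 (Ordinal kN)).
  - rewrite map_inj_uniq ?iota_uniq // => i j /eqP.
    by rewrite eqr_nat eqn_pmul2l // => /eqP.
have: mxminpoly X %| 'X^K.
  by apply: mxminpoly_min; rewrite rmorphXn /= horner_mx_X.
rewrite -[X in X ^+ _]subr0 -polyC0 => /dvdp_exp_XsubCP[j jK eqp].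
have jn : (j <= n.+1)%N.
  have := dvdp_leq _ (mxminpoly_dvd_char X).
  rewrite -size_poly_eq0 size_char_poly => /(_ isT).
  by rewrite (eqp_size eqp) size_exp_XsubC.
have : horner_mx X (('X - 0%:P) ^+ j) = 0.
  by apply/mxminpoly_minP; rewrite (eqp_dvdl _ eqp) dvdpp.
rewrite polyC0 subr0 rmorphXn /= horner_mx_X => Xj.
suff -> : X ^+ n.+1 = X ^+ (n.+1 - j) * X ^+ j by rewrite Xj mulr0.
by rewrite -exprD subnK.
Qed.

Section Exponential.
Variables (R : comPzRingType) (n : nat) (X : 'M[int]_n).
Hypothesis X_nil : X ^+ n = 0.
Hypothesis X_div : forall m i j, (m`! %| (X ^+ m) i j)%Z.

Let nilX m : (n <= m)%N -> X ^+ m = 0.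
Proof. by move=> nm; rewrite -(subnK nm) exprD X_nil mulr0. Qed.

Lemma divpowE m : m`!%:Z *: divpow X m = X ^+ m.
Proof. by apply/matrixP => i j; rewrite !mxE mulrC divzK. Qed.

Lemma divpow_eq0 m : (n <= m)%N -> divpow X m = 0.
Proof. by move=> /nilX Xm; apply/matrixP => i j; rewrite !mxE Xm mxE div0z. Qed.

Lemma divpow0 : divpow X 0 = 1%:M.
Proof. by have := divpowE 0; rewrite fact0 scale1r expr0. Qed.

Lemma divpowM i j :
  divpow X i *m divpow X j = 'C(i + j, i)%:Z *: divpow X (i + j).
Proof.
have nz : (i`! * j`!)%:Z != 0 by rewrite -lt0n muln_gt0 !fact_gt0.
suff E : (i`! * j`!)%:Z *: (divpow X i *m divpow X j) =
         (i`! * j`!)%:Z *: ('C(i + j, i)%:Z *: divpow X (i + j)).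
  apply/matrixP => r s; apply: (mulfI nz).
  by move/matrixP: E => /(_ r s); rewrite [LHS]mxE [RHS]mxE.
rewrite scalerA -PoszM [(_ * 'C(_, _))%N]mulnC.
have -> : ('C(i + j, i) * (i`! * j`!))%N = (i + j)`!.
  by rewrite -(bin_fact (leq_addr j i)) addKn.
by rewrite divpowE exprD -!divpowE PoszM -scalerA scalemxAr scalemxAl.
Qed.

Lemma expmxD (xi zeta : R) : expmx X xi *m expmx X zeta = expmx X (xi + zeta).
Proof.
pose D m : 'M[R]_n := map_mx intr (divpow X m).
have D0 m : (n <= m)%N -> D m = 0 by move=> nm; rewrite /D divpow_eq0 // map_mx0.
have DM i j : D i *m D j = 'C(i + j, i)%:R *: D (i + j)%N.
  by rewrite /D -map_mxM divpowM map_mxZ.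
pose G i k : 'M[R]_n := ('C(k, i)%:R * (xi ^+ i * zeta ^+ (k - i))) *: D k.
transitivity (\sum_(0 <= i < n) \sum_(0 <= k < n | (i <= k)%N) G i k).
  rewrite mulmx_suml big_mkord; apply: eq_bigr => i _.
  rewrite mulmx_sumr -(big_mkord xpredT
    (fun j => (xi ^+ i *: D i) *m (zeta ^+ j *: D j))).
  transitivity (\sum_(i <= k < (n + i)%N) G i k).
    have := @big_addn _ 0 +%R 0 (n + i) i xpredT (G i).
    rewrite add0n addnK => ->.
    apply: eq_bigr => j _; rewrite /G addnK addnC -scalemxAl -scalemxAr !scalerA.
    by rewrite DM scalerA mulrC.
  rewrite [LHS](big_cat_nat (ltnW (ltn_ord i)) (leq_addr i n)) /=.
  rewrite [X in _ + X]big_nat_cond.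
  rewrite [X in _ + X]big1 => [|k]; last first.
    by rewrite andbT => /andP[nk _]; rewrite /G D0 ?scaler0.
  rewrite addr0 [RHS](big_cat_nat (leq0n i) (ltnW (ltn_ord i))) /=.
  rewrite [X in X + _]big_nat_cond [X in X + _]big1 => [|k]; last first.
    by case/andP => /andP[_ ki]; rewrite leqNgt ki.
  rewrite add0r big_nat_cond [RHS]big_nat_cond; apply: eq_bigl => k.
  by case: (leqP i k).
rewrite (exchange_big_dep_nat xpredT) //= big_mkord; apply: eq_bigr => k _.
rewrite -/(D k) -scaler_suml addrC exprDn; congr (_ *: _).
rewrite [RHS](eq_bigr (fun i : 'I_k.+1 =>
  'C(k, i)%:R * (xi ^+ i * zeta ^+ (k - i)))) => [|i _]; last first.
  by rewrite mulr_natl mulrC.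
rewrite -(big_mkord xpredT (fun i => 'C(k, i)%:R * (xi ^+ i * zeta ^+ (k - i)))).
rewrite [LHS](@big_cat_nat _ _ _ k.+1) //=.
rewrite [X in _ + X]big_nat_cond [X in _ + X]big1 => [|i]; last first.
  by case/andP => /andP[ki _]; rewrite leqNgt ki.
rewrite addr0 big_nat_cond [RHS]big_nat_cond; apply: eq_bigl => i.
by rewrite ltnS; case: (leqP i k); rewrite ?andbF.
Qed.

Lemma expmx0 : expmx X (0 : R) = 1%:M.
Proof.
rewrite /expmx; case: n X divpow0 => [|n'] X' X0.
  by rewrite [LHS]thinmx0 [RHS]thinmx0.
rewrite big_ord_recl /= X0 map_mx1 expr0 scale1r big1 ?addr0 // => i _.
by rewrite exprS mul0r scale0r.
Qed.
End Exponential.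

(** * The group GL_n(R), as matrices paired with their inverses *)

Section GL.
Variables (R : comPzRingType) (n : nat).

Definition invpair : pred ('M[R]_n * 'M[R]_n) :=
  fun p => (p.1 *m p.2 == 1%:M) && (p.2 *m p.1 == 1%:M).

Record GL := MkGL { gl_pair : 'M[R]_n * 'M[R]_n; _ : invpair gl_pair }.

HB.instance Definition _ := [isSub for gl_pair].
HB.instance Definition _ := [Choice of GL by <:].

Definition glmx (g : GL) : 'M[R]_n := (gl_pair g).1.
Definition glinv (g : GL) : 'M[R]_n := (gl_pair g).2.

Lemma gl_mulmxV g : glmx g *m glinv g = 1%:M.
Proof. by case: g => p hp; case/andP: (hp) => /eqP. Qed.

Lemma gl_mulVmx g : glinv g *m glmx g = 1%:M.
Proof. by case: g => p hp; case/andP: (hp) => _ /eqP. Qed.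

Lemma glmx_inj : injective glmx.
Proof.
move=> g h gh; apply: val_inj; rewrite /=.
have gh' : glinv g = glinv h.
  by rewrite -[LHS]mulmx1 -(gl_mulmxV h) mulmxA -gh gl_mulVmx mul1mx.
by move: gh gh'; rewrite /glmx /glinv; case: (gl_pair g) (gl_pair h) =>
  [? ?] [? ?] /= -> ->.
Qed.

Fact gl_one_subproof : invpair (1%:M, 1%:M).
Proof. by rewrite /invpair /= mulmx1 eqxx. Qed.

Fact gl_mul_subproof (g h : GL) :
  invpair (glmx g *m glmx h, glinv h *m glinv g).
Proof.
rewrite /invpair /= mulmxA -(mulmxA (glmx g)) gl_mulmxV mulmx1 gl_mulmxV.
by rewrite mulmxA -(mulmxA (glinv h)) gl_mulVmx mulmx1 gl_mulVmx eqxx.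
Qed.

Fact gl_inv_subproof (g : GL) : invpair (glinv g, glmx g).
Proof. by rewrite /invpair /= gl_mulmxV gl_mulVmx eqxx. Qed.

Definition gl_one := MkGL gl_one_subproof.
Definition gl_mul g h := MkGL (gl_mul_subproof g h).
Definition gl_inv g := MkGL (gl_inv_subproof g).

Fact gl_mulA : associative gl_mul.
Proof. by move=> f g h; apply: glmx_inj; rewrite /glmx /= mulmxA. Qed.
Fact gl_mul1 : left_id gl_one gl_mul.
Proof. by move=> g; apply: glmx_inj; rewrite /glmx /= mul1mx. Qed.
Fact gl_mulr1 : right_id gl_one gl_mul.
Proof. by move=> g; apply: glmx_inj; rewrite /glmx /= mulmx1. Qed.
Fact gl_mulV : left_inverse gl_one gl_inv gl_mul.
Proof. by move=> g; apply: glmx_inj; rewrite /glmx /= -/(glmx g) gl_mulVmx. Qed.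
Fact gl_mulrV : right_inverse gl_one gl_inv gl_mul.
Proof. by move=> g; apply: glmx_inj; rewrite /glmx /= -/(glmx g) gl_mulmxV. Qed.

HB.instance Definition _ :=
  isGroup.Build GL gl_mulA gl_mul1 gl_mulr1 gl_mulV gl_mulrV.

Lemma glmx1 : glmx 1%g = 1%:M. Proof. by []. Qed.
Lemma glmxM g h : glmx (g * h)%g = glmx g *m glmx h. Proof. by []. Qed.
Lemma glmxV g : glmx (g^-1)%g = glinv g. Proof. by []. Qed.

End GL.

(** * Subgroups of a possibly infinite group *)

Section Subgroups.
Variable G : groupType.
Implicit Types (S H N E : G -> Prop) (g h x y : G).

Inductive generated S : G -> Prop :=
| generated_in g : S g -> generated S g
| generated_1 : generated S 1%g
| generated_M g h : generated S g -> generated S h -> generated S (g * h)%g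
| generated_V g : generated S g -> generated S (g^-1)%g.

Definition conjl x y : G := (x * y * x^-1)%g.

(* not the library's [~ x, y], which is x^-1 y^-1 x y *)
Definition comml x y : G := (x * y * x^-1 * y^-1)%g.

(* the normal closure of H in E, for H a subset of the subgroup E *)
Definition normal_closure E H : G -> Prop :=
  generated (fun g => exists x y, [/\ E x, H y & g = conjl x y]).

Definition congr_mod N g h : Prop := N (g^-1 * h)%g.

End Subgroups.

(** * Ideals *)

Section Ideals.
Variable R : comPzRingType.
Implicit Types (A B I : R -> Prop).

Record ideal I : Prop := Ideal {
  ideal0 : I 0;
  idealD : forall x y, I x -> I y -> I (x + y);
  idealM : forall r x, I x -> I (r * x) }.

Definition ideal_mul A B (r : R) : Prop :=
  exists s : seq (R * R), {in s, forall p, A p.1 /\ B p.2} /\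
    r = \sum_(p <- s) p.1 * p.2.

Definition maximal_ideal I : Prop :=
  [/\ ideal I, ~ I 1 & forall J : R -> Prop, ideal J ->
      (forall x, I x -> J x) -> (forall x, J x -> I x) \/ J 1].

Definition quotient_has_two_elements I : Prop :=
  exists u v, ~ I (u - v) /\ forall x, I (x - u) \/ I (x - v).

Definition has_residue_field_of_two_elements : Prop :=
  exists M, maximal_ideal M /\ quotient_has_two_elements M.

End Ideals.

(** * Elementary subgroups *)

Section Elementary.
Variables (F : rcfType) (l : nat) (Phi : seq 'rV[F]_l) (n : nat).
Variables (e : 'rV[F]_l -> 'M[int]_n) (R : comPzRingType).
Implicit Types (a : 'rV[F]_l) (xi : R) (I : R -> Prop).

(* x_a(xi) = exp(xi e_a).  The default value 1 of insubd is not reached when a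
   is a root: see glmx_xroot. *)
Definition xroot a xi : GL R n :=
  insubd (1%g : GL R n) (expmx (e a) xi, expmx (e a) (- xi)).

(* E(Phi, I); taking I = R gives E(Phi, R) *)
Definition elementary I : GL R n -> Prop :=
  generated (fun g => exists a xi, [/\ a \in Phi, I xi & g = xroot a xi]).

Definition absolute_elementary : GL R n -> Prop := elementary (fun=> True).

(* E(Phi, R, I) *)
Definition relative_elementary I : GL R n -> Prop :=
  normal_closure absolute_elementary (elementary I).

(* y_a(xi, zeta) *)
Definition yroot a xi zeta : GL R n := comml (xroot a xi) (xroot (- a) zeta).

Hypotheses (Phi_root : root_system Phi) (Phi_chev : chevalley_module Phi e).

Lemma pairing_self a : a \in Phi -> pairing a a = 2.
Proof.
move=> aPhi; rewrite /pairing mulfK //; apply: contraTneq aPhi => a0.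
suff -> : a = 0 by exact: root_neq0 Phi_root.
apply/rowP => i; rewrite mxE; apply/eqP; rewrite -sqrf_eq0 expr2.
have /psumr_eq0P/(_ a0 i isT) -> // : forall i, true -> 0 <= a 0 i * a 0 i.
by move=> j _; rewrite -expr2 sqr_ge0.
Qed.

Lemma chev_nilpotent a : a \in Phi -> e a ^+ n = 0.
Proof.
move=> aPhi; apply: (@nilpotent_of_lie _ (lie (e a) (e (- a)))).
by apply: (chev_cartan Phi_chev) => //; exact: pairing_self.
Qed.

Lemma glmx_xroot a xi : a \in Phi -> glmx (xroot a xi) = expmx (e a) xi.
Proof.
move=> aPhi; rewrite /glmx /xroot -[gl_pair _]/(val _) val_insubd ifT //.
rewrite /invpair /= !expmxD ?subrr ?addNr ?expmx0 ?eqxx //;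
  do [exact: chev_nilpotent | by move=> m; exact: (chev_admissible Phi_chev)].
Qed.

End Elementary.

(* Main.v *)
(** Let N = E(Phi, R, AB) and y = [x_a(u), x_(-a)(v)].  By the Chevalley
commutator formula, root elements with parameters in A and in B commute modulo
N as soon as their roots are not opposite.  If b is not proportional to a, then
conjugation by x_b(xi) multiplies x_a(u) and x_(-a)(v) by products of elements
for roots i a + j b and - i a + j b with i, j > 0 and parameters in A and B; no
two of the roots involved are opposite except a and -a, so x_b(xi) commutes with
y modulo N.  The remaining x_a(xi) and x_(-a)(xi) are reached through the
commutator formula again: +-a = d + k g, where d is the bottom of a g-string,
and x_(+-a)(+-xi) is the factor for d + k g in [x_g(1), x_d(xi)], all other
factors being already known to commute with y.

The commutator formula is obtained from
  x_g(s) exp(t e_d) x_g(s)^-1 = exp(t (Y_0 + Y_1 + Y_2 + Y_3)),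
  Y_k = c_k s^k e_(d + k g).
If no j d + k g with j > 2 is a root (true for (g, d) or for (d, g)), the
brackets [Y_i, Y_j] are central, and the exponential splits as
exp(t^2 W) exp(t Y_3) ... exp(t Y_0) with 2 W a sum of brackets.  W has integral
coefficients: Y^2 / 2 is conjugate to the integral matrix e_d^2 / 2, so W is
integral, and a root vector is never divisible by 2.  Identities between
exponentials are proved over Z[s][t], where a polynomial in t is determined by a
first-order linear differential equation and its constant term. *)

Require Import Defs.
From HB Require Import structures.
From mathcomp Require Import all_boot all_order all_fingroup all_algebra.
From mathcomp Require Import ring lra zify.

Set Implicit Arguments.
Unset Strict Implicit.
Unset Printing Implicit Defensive.

Import Order.TTheory GRing.Theory Num.Theory.

Local Open Scope ring_scope.

(** * Exponentials as polynomials in divided powers *)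

(** Cancelling positive integers takes the place of dividing by them, since all coefficients stay
    integral. *)
Definition torsion_free (A : nmodType) : Prop :=
  forall (x : A) m, x *+ m.+1 = 0 -> x = 0.

Lemma torsion_free_poly (A : nzRingType) :
  torsion_free A -> torsion_free {poly A}.
Proof.
move=> tf p m pm; apply/polyP => i; rewrite coef0; apply: (tf _ m).
by rewrite -coefMn pm coef0.
Qed.

Lemma torsion_free_mx m n : torsion_free 'M[int]_(m, n).
Proof.
move=> X k /matrixP Xk; apply/matrixP => i j.
by have := Xk i j; rewrite mulmxnE !mxE => /eqP; rewrite mulrn_eq0 => /eqP.
Qed.

Section Divided.
Variable A : nzRingType.
Hypothesis tf : torsion_free A.
Implicit Types (X Y Z : A) (U V L : {poly A}).

Lemma mulrnI (x y : A) m : x *+ m.+1 = y *+ m.+1 -> x = y.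
Proof.
by move=> xy; apply/subr0_eq/(tf (m := m)); rewrite mulrnBl xy subrr.
Qed.

(** The coefficient of t^m in the equation expresses (m + 1) U_(m+1) through U_0, ..., U_m, and
    torsion-freeness cancels m + 1. *)
Lemma ode_unique L U V :
  U^`() = L * U -> V^`() = L * V -> U`_0 = V`_0 -> U = V.
Proof.
move=> dU dV UV0; apply/polyP; elim/ltn_ind => -[//|m] IH.
apply: (mulrnI (m := m)); rewrite -!coef_deriv dU dV !coefM.
by apply: eq_bigr => i _; rewrite IH // ltnS leq_subr.
Qed.

(* [D m] plays the role of X^m / m!, and X^N = 0. *)
Record divided (N : nat) X (D : nat -> A) : Prop := Divided {
  divided0 : D 0%N = 1;
  dividedS : forall m, X * D m = D m.+1 *+ m.+1;
  divided_eq0 : forall m, (N <= m)%N -> D m = 0 }.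

(* exp (t^j X) *)
Definition expp (N : nat) (D : nat -> A) (j : nat) : {poly A} :=
  \sum_(m < N) (D m)%:P * 'X^(j * m).

Section Exp.
Variables (N : nat) (X : A) (D : nat -> A).
Hypothesis hD : divided N X D.

Lemma divided_gt0 : (0 < N)%N.
Proof.
case: N hD => // -[D0 _ /(_ 0%N isT)].
by rewrite D0 => /eqP; rewrite oner_eq0.
Qed.

Lemma divided_comm Z : lie X Z = 0 -> forall m, Z * D m = D m * Z.
Proof.
move=> /subr0_eq XZ; elim=> [|m IH]; first by rewrite (divided0 hD) mulr1 mul1r.
apply: (mulrnI (m := m)); rewrite -mulrnAr -mulrnAl -(dividedS hD).
by rewrite mulrA -XZ -!mulrA IH.
Qed.

Lemma expp_comm j Z : lie X Z = 0 -> Z%:P * expp N D j = expp N D j * Z%:P.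
Proof.
move=> XZ; rewrite mulr_sumr mulr_suml; apply: eq_bigr => m _.
by rewrite mulrA -polyCM divided_comm // polyCM -!mulrA commr_polyXn.
Qed.

Lemma coef0_expp j : (expp N D j.+1)`_0 = 1.
Proof.
rewrite coef_sum -(prednK divided_gt0) big_ord_recl /= muln0 mulr1 coefC eqxx.
rewrite (divided0 hD) big1 ?addr0 // => i _.
by rewrite coefMXn muln_gt0.
Qed.

Lemma deriv_expp j :
  (expp N D j.+1)^`() = X%:P * 'X^j *+ j.+1 * expp N D j.+1.
Proof.
(* The term m = 0 on the left is constant, and the top term on the right vanishes since D N = 0. *)
rewrite /expp linear_sum mulr_sumr -[in LHS](prednK divided_gt0) big_ord_recl.
rewrite /= muln0 mulr1 derivC add0r.
rewrite -[in RHS](prednK divided_gt0) big_ord_recr /=.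
have XDP m : X%:P * 'X^j *+ j.+1 * ((D m)%:P * 'X^(j.+1 * m)) =
    (D m.+1)%:P * 'X^(j.+1 * m + j) *+ (j.+1 * m.+1).
  rewrite mulrnAl [(j.+1 * m.+1)%N]mulnC mulrnA; congr (_ *+ _).
  rewrite -mulrA (mulrA 'X^j) -commr_polyXn -mulrA -exprD addnC mulrA.
  by rewrite -polyCM (dividedS hD) polyCMn mulrnAl.
rewrite XDP (divided_eq0 hD) ?prednK ?divided_gt0 // mul0r mul0rn addr0.
apply: eq_bigr => i _; rewrite XDP derivM derivC mul0r add0r derivXn /=.
by rewrite /bump leq0n add1n mulrnAr; congr (_ * 'X^_ *+ _); lia.
Qed.

(* [exp (tX) Y exp (-tX) = Y + t [X, Y]] when [X, Y] commutes with [X] *)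
Lemma expp_conj Y : lie X (lie X Y) = 0 ->
  expp N D 1 * Y%:P = (Y%:P + 'X * (lie X Y)%:P) * expp N D 1.
Proof.
set Z := lie X Y => XZ; set F := expp N D 1.
have dF : F^`() = X%:P * F by rewrite deriv_expp expr0 mulr1.
have FZ : Z%:P * F = F * Z%:P by exact: expp_comm.
(* Both sides solve U' = X U and have constant term Y. *)
apply: (ode_unique (L := X%:P)).
- by rewrite derivM derivC mulr0 addr0 dF mulrA.
- rewrite derivM derivD derivC derivM derivX derivC mulr0 addr0 add0r mul1r dF.
  have YX : Y%:P * X%:P = X%:P * Y%:P - Z%:P.
    by rewrite -!polyCM -polyCB /Z /lie opprB addrC subrK.
  have XZP : Z%:P * X%:P = X%:P * Z%:P by rewrite -!polyCM (subr0_eq XZ).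
  rewrite !mulrA -mulrDl; congr (_ * F); rewrite mulrDl mulrDr YX.
  rewrite addrA [Z%:P + _]addrC subrK; congr (_ + _).
  by rewrite -mulrA XZP mulrA -commr_polyX -mulrA.
- rewrite coefMC mulrDl coefD -mulrA -commr_polyX coefMX addr0 coefCM.
  by rewrite coef0_expp mulr1 mul1r.
Qed.
End Exp.
End Divided.

Section Lie.
Variable A : nzRingType.
Implicit Types x y z : A.

Lemma lie0r x : lie x 0 = 0. Proof. by rewrite /lie mulr0 mul0r subrr. Qed.

Lemma lieDr x y z : lie x (y + z) = lie x y + lie x z.
Proof. by rewrite /lie mulrDr mulrDl opprD addrACA. Qed.

Lemma lie_sumr x I (r : seq I) (F : I -> A) :
  lie x (\sum_(i <- r) F i) = \sum_(i <- r) lie x (F i).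
Proof.
by elim/big_rec2: _ => [|i y z _ <-]; [exact: lie0r | exact: lieDr].
Qed.
End Lie.

(** * Splitting the exponential of a sum with central brackets *)

Section Zassenhaus.
Variable A : nzRingType.
Hypothesis tf : torsion_free A.
Variables (N : nat) (Y W : nat -> A) (DY DW : nat -> nat -> A).
Hypothesis hDY : forall k, divided N (Y k) (DY k).
Hypothesis hDW : forall k, divided N (W k) (DW k).
Hypothesis YYY : forall i j k, lie (Y i) (lie (Y j) (Y k)) = 0.
Hypothesis WY : forall i j, lie (W i) (Y j) = 0.
Hypothesis WW : forall i j, lie (W i) (W j) = 0.

(* the sum of the [Y i, Y j] over the pairs such that i occurs before j *)
Fixpoint brackets (ks : seq nat) : A :=
  if ks is k :: ks' then lie (Y k) (\sum_(j <- ks') Y j) + brackets ks' else 0.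

Lemma lie_brackets i ks : lie (Y i) (brackets ks) = 0.
Proof.
elim: ks => [|k ks IH] /=; first exact: lie0r.
by rewrite lieDr IH addr0 !lie_sumr big1.
Qed.

(** Moving exp (t Y_k) past the sum S of the later terms adds t [Y_k, S], by [expp_conj]. These
    brackets commute with every Y_i and add up to [brackets]. *)
Lemma deriv_prod_exp ks (P := \prod_(k <- ks) expp N (DY k) 1) :
  P^`() = ((\sum_(k <- ks) Y k)%:P + 'X * (brackets ks)%:P) * P.
Proof.
rewrite {}/P; elim: ks => [|k ks IH].
  by rewrite !big_nil derivC mulr0 addr0 mul0r.
rewrite !big_cons /= derivM IH (deriv_expp (hDY k)) expr0 mulr1 mulr1n.
set S := \sum_(j <- ks) Y j; set F := expp _ _ _; set b := brackets ks.
rewrite [F * (_ * _)]mulrA -mulrDl [RHS]mulrA; congr (_ * _).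
rewrite [F * (_ + _)]mulrDr.
have -> : F * S%:P = (S%:P + 'X * (lie (Y k) S)%:P) * F.
  by apply: (expp_conj tf (hDY k)); rewrite !lie_sumr big1.
have -> : F * ('X * b%:P) = 'X * b%:P * F.
  rewrite mulrA (commr_polyX F) -!mulrA; congr (_ * _); apply/esym.
  by apply: (expp_comm tf (hDY k)); exact: lie_brackets.
rewrite -!mulrDl; congr (_ * _).
by move: (lie _ _) => Z; rewrite !polyCD mulrDr !addrA.
Qed.

Lemma prod_expW_comm rs Z : (forall r, lie (W r) Z = 0) ->
  Z%:P * \prod_(r <- rs) expp N (DW r) 2 =
  \prod_(r <- rs) expp N (DW r) 2 * Z%:P.
Proof.
move=> WZ; elim: rs => [|r rs IH]; first by rewrite big_nil mulr1 mul1r.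
by rewrite big_cons mulrA (expp_comm tf (hDW r)) // -mulrA IH mulrA.
Qed.

Lemma deriv_prod_expW rs (G := \prod_(r <- rs) expp N (DW r) 2) :
  G^`() = 'X * (\sum_(r <- rs) W r)%:P *+ 2 * G.
Proof.
rewrite {}/G; elim: rs => [|r rs IH].
  by rewrite !big_nil derivC mulr0 mul0rn mul0r.
rewrite !big_cons derivM IH (deriv_expp (hDW r)) expr1.
rewrite [expp _ _ _ * (_ * _)]mulrA -mulrDl [RHS]mulrA; congr (_ * _).
set S := \sum_(s <- rs) W s; set E := expp _ _ _.
have -> : E * ('X * S%:P *+ 2) = 'X * S%:P *+ 2 * E.
  rewrite mulrnAr mulrnAl mulrA (commr_polyX E) -!mulrA.
  by rewrite (expp_comm tf (hDW r)) // lie_sumr big1.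
by rewrite -mulrDl -mulrnDl commr_polyX -mulrDr -polyCD.
Qed.

(* Hence V = exp (t (sum of the Y k)), by [ode_unique]. *)
Lemma zassenhaus ks rs
    (V := \prod_(r <- rs) expp N (DW r) 2 * \prod_(k <- ks) expp N (DY k) 1) :
  (\sum_(r <- rs) W r) *+ 2 = - brackets ks ->
  V^`() = (\sum_(k <- ks) Y k)%:P * V /\ V`_0 = 1.
Proof.
move=> W2; split; last first.
  rewrite /V coef0M.
  rewrite !(big_morph (fun p : {poly A} => p`_0) (@coef0M A) (coef1 _ 0)).
  rewrite !big1 ?mulr1 // => [k _|r _]; first exact: (coef0_expp (hDY k)).
  exact: (coef0_expp (hDW r)).
(* The W r contribute 2 t times their sum, which cancels t times [brackets]. *)
rewrite /V derivM deriv_prod_exp deriv_prod_expW.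
set G := \prod_(r <- rs) _; set P := \prod_(k <- ks) _.
rewrite [G * (_ * P)]mulrA -mulrDl mulrA; congr (_ * _).
have WS r : lie (W r) (\sum_(k <- ks) Y k) = 0 by rewrite lie_sumr big1.
have Wb r : lie (W r) (brackets ks) = 0.
  rewrite -[brackets ks]opprK -W2 -mulNrn -sumrN -sumrMnl lie_sumr.
  rewrite big1 // => i _; rewrite /lie mulrnAl mulrnAr -mulrnBl mulrN mulNr.
  by rewrite opprK addrC -/(lie (W i) (W r)) WW mul0rn.
rewrite mulrDr -(prod_expW_comm rs WS) mulrA (commr_polyX G) -mulrA.
rewrite -(prod_expW_comm rs Wb) -[brackets ks]opprK -W2 polyCN polyCMn.
by rewrite mulNr mulrN mulrA -mulrnAr addrC subrK.
Qed.
End Zassenhaus.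

(** * Root vectors are not divisible by 2 *)

(** Legendre's formula: the exponent of 2 in m! is the sum of the floors of m / 2^k. *)
Lemma logn2_fact_lt m : (0 < m)%N -> (logn 2 m`! < m)%N.
Proof.
move=> m0; rewrite logn_fact //.
(* Counting the last term twice makes the induction work: twice the floor of m / 2^(K+1) is at most
   the floor of m / 2^K. *)
have S K : (\sum_(1 <= k < K.+1) m %/ 2 ^ k + m %/ 2 ^ K <= m)%N.
  elim: K => [|K IH]; first by rewrite big_geq // expn0 divn1.
  rewrite big_nat_recr //=; apply: leq_trans IH; rewrite -addnA leq_add2l.
  by rewrite expnSr divnMA addnn -muln2 leq_trunc_div.
(* For the largest K with 2^K <= m the extra term is positive, which makes the bound strict, and all
   later terms vanish. *)
have [lo hi] := andP (trunc_log_bounds (isT : (1 < 2)%N) m0).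
set K := trunc_log 2 m in lo hi.
have Km : (K <= m)%N by apply: leq_trans (ltnW (ltn_expl _ _)) lo.
rewrite (@big_cat_nat _ _ _ K.+1) //= [X in (_ + X)%N]big_nat_cond.
rewrite [X in (_ + X)%N]big1 ?addn0.
  by apply: leq_trans (S K); rewrite -addn1 leq_add2l divn_gt0 ?expn_gt0.
move=> k /andP[/andP[Kk _] _]; apply: divn_small; apply: leq_trans hi _.
by rewrite leq_exp2l.
Qed.

(** * The action of sl_2 by left multiplication *)

Section SL2.
Variable A : nzRingType.
Variables x y : A.
Let h := lie x y.
Hypothesis hx : lie h x = x *+ 2.
Hypothesis hy : lie h y = - (y *+ 2).

Let xy : x * y = y * x + h. Proof. by rewrite /h /lie addrC subrK. Qed.
Let xh : x * h = h * x - x *+ 2.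
Proof. by rewrite -hx /lie opprB addrC subrK. Qed.
Let hyE : h * y = y * h - y *+ 2.
Proof. by rewrite -hy /lie addrC subrK. Qed.

(** When x ^+ k.+1 = 0, cancelling k + 1 gives h x^k = k x^k: the last nonzero power of x has weight
    k. *)
Lemma sl2_comm_power k :
  x ^+ k.+1 * y = y * x ^+ k.+1 + (h - k%:R) * x ^+ k *+ k.+1.
Proof.
elim: k => [|k IH]; first by rewrite !expr1 expr0 subr0 mulr1 xy.
have xhk : x * (h - k%:R) = (h - k.+2%:R) * x.
  rewrite mulrBr xh mulrBl -addrA -opprD mulr_natr mulr_natl.
  by rewrite -mulrnDr add2n.
rewrite exprS -mulrA IH mulrDr mulrA xy mulrDl -mulrA -exprS -addrA.
congr (_ + _); rewrite mulrnAr mulrA xhk -mulrA -exprS.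
move: (h) (x ^+ k.+1) => g X.
rewrite !mulrBl !mulr_natl !mulrnBl -!mulrnA addrA -mulrS.
by congr (_ - _ *+ _); lia.
Qed.

Section Top.
Variables (P : A) (m : nat).
Hypothesis xP : x * P = 0.
Hypothesis hP : h * P = P *+ m.

(** P behaves as a highest weight vector of weight m, and y lowers weights by 2. *)
Lemma sl2_weight j : h * (y ^+ j * P) = (y ^+ j * P) *~ (m%:Z - (2 * j)%:Z).
Proof.
elim: j => [|j IH]; first by rewrite expr0 !mul1r muln0 subr0.
rewrite exprS -!mulrA [h * _]mulrA hyE mulrBl -mulrA IH mulrzAr mulrnAl.
rewrite -[_ *+ 2]/(_ *~ 2) -mulrzBr; congr (_ *~ _); lia.
Qed.

Lemma sl2_raise j :
  x * (y ^+ j.+1 * P) = (y ^+ j * P) *~ (j.+1%:Z * (m%:Z - j%:Z)).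
Proof.
elim: j => [|j IH].
  rewrite expr1 expr0 mulrA xy mulrDl -mulrA xP mulr0 add0r hP mul1r.
  by rewrite mul1r subr0.
rewrite [y ^+ j.+2]exprS -mulrA [x * _]mulrA xy mulrDl -mulrA IH sl2_weight.
rewrite mulrzAr mulrA -exprS.
rewrite -mulrzDr; congr (_ *~ _); lia.
Qed.

(** By [sl2_raise] the m raisings multiply P by the product of the i (m - i + 1) for 1 <= i <= m. *)
Lemma sl2_up_down : x ^+ m * (y ^+ m * P) = P *+ (m`! * m`!).
Proof.
have S i : (i <= m)%N -> x ^+ i * (y ^+ i * P) = P *+ (i`! * m ^_ i).
  elim: i => [|i IH] im; first by rewrite !expr0 !mul1r.
  rewrite exprSr -mulrA sl2_raise mulrzAr IH ?(ltnW im) //.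
  rewrite subzn ?(ltnW im) // -PoszM -pmulrn -mulrnA factS ffactnSr.
  by congr (_ *+ _); lia.
by rewrite S // ffactnn.
Qed.
End Top.
End SL2.

Definition even_mx m n (X : 'M[int]_(m, n)) := exists Z, X = 2 *: Z.

(* If x^(m) = x^m / m! is the last nonzero divided power, then
   x^(m) y^(m) x^(m) = x^(m), so x^(m) is odd; but 2 | x would give
   2^m | m! x^(m), while 2^m does not divide m!. *)
Lemma root_vector_odd n (x y : 'M[int]_n.+1) :
  lie (lie x y) x = 2 *: x -> lie (lie x y) y = - (2 *: y) ->
  (forall m i j, (m`! %| (x ^+ m) i j)%Z) ->
  (forall m i j, (m`! %| (y ^+ m) i j)%Z) ->
  x != 0 -> ~ even_mx x.
Proof.
move=> hx hy dx dy x0 [z xz].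
have xn : x ^+ n.+1 = 0 by exact: nilpotent_of_lie hx.
have hx' : lie (lie x y) x = x *+ 2 by rewrite hx -scaler_nat.
have hy' : lie (lie x y) y = - (y *+ 2) by rewrite hy -scaler_nat.
have ex : exists m, x ^+ m.+1 == 0 by exists n; rewrite xn.
have [m /eqP xm minm] := ex_minnP ex.
have m0 : (0 < m)%N by case: m xm {minm} => // /eqP; rewrite expr1 (negbTE x0).
have xm0 : x ^+ m != 0.
  apply/eqP => xm0; have := minm m.-1; rewrite prednK // xm0 eqxx => /(_ isT).
  by rewrite leqNgt prednK ?leqnn.
have hP : lie x y * x ^+ m = x ^+ m *+ m.
  have := sl2_comm_power hx' m; rewrite xm mul0r mulr0 add0r.
  by move/esym/torsion_free_mx/eqP; rewrite mulrBl mulr_natl subr_eq0 => /eqP.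
have xP : x * x ^+ m = 0 by rewrite -exprS.
have := sl2_up_down hy' xP hP.
rewrite -(divpowE dx m) -(divpowE dy m) in xm0 *.
set p := divpow x m in xm0 *; set q := divpow y m => pqp0.
have pqp : p * q * p = p.
  apply: (mulrnI (@torsion_free_mx _ _) (m := (m`! * m`! * m`!).-1)).
  rewrite prednK ?muln_gt0 ?fact_gt0 //; move: pqp0.
  rewrite -!scalerAl -!scalerAr !scalerA mulrA -!PoszM.
  rewrite -!scaler_nat !natz scalerA -PoszM => E.
  by rewrite -mulnA E mulnC.
(* One factor 2 is enough to start: p = 2^k r gives p = p q p = 2^(2k) r q r, so p is divisible by
   every power of 2. *)
have p2 k : exists r, p = (2 ^ k)%:Z *: r.
  have ph : exists r, p = 2 *: r.
    pose v := logn 2 m`!; have vm : (v < m)%N := logn2_fact_lt m0.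
    have [u u_odd mu] : exists2 u, odd u & m`! = (2 ^ v * u)%N.
      have [u] := pfactor_coprime (isT : prime 2) (fact_gt0 m).
      by rewrite coprime2n => u_odd ->; exists u; rewrite // mulnC.
    (* From m! p = x^m = 2^m z^m, cancelling the 2-part 2^v of m!. *)
    have up : u%:Z *: p = (2 ^ (m - v))%:Z *: z ^+ m.
      apply: (@mulrnI _ (@torsion_free_mx _ _) _ _ (2 ^ v).-1).
      rewrite prednK ?expn_gt0 // -!scaler_nat !natz !scalerA -!PoszM -mu.
      rewrite divpowE // xz exprZn -expnD subnKC ?(ltnW vm) //.
      by congr (_ *: _); rewrite -natz natrX.
    (* As u is odd, p = u p - 2 (u./2) p, and 2^(m - v) is even because v < m. *)
    exists ((2 ^ (m - v).-1)%:Z *: z ^+ m - (u./2)%:Z *: p).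
    rewrite scalerBr !scalerA -!PoszM -expnS prednK ?subn_gt0 // -up -scalerBl.
    by rewrite mul2n -[u in u%:Z]odd_double_half u_odd PoszD addrK scale1r.
  elim: k => [|k [r pr]]; first by exists p; rewrite scale1r.
  case: k pr => [_|k pr]; first exact: ph.
  exists ((2 ^ k)%:Z *: (r * q * r)).
  rewrite -pqp pr -!scalerAl -!scalerAr !scalerA -!PoszM; congr (_%:Z *: _).
  by rewrite -!expnD; congr expn; lia.
clearbody p q; case/negP: xm0; apply/eqP/matrixP => i j; rewrite !mxE.
(* An integer k divisible by 2^|k| is 0. *)
have [r pr] := p2 `|p i j|%N; have := congr1 (fun M : 'M_n.+1 => `|M i j|%N) pr.
rewrite /= mxE abszM absz_nat => pij; suff : `|p i j|%N == 0%N.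
  by rewrite absz_eq0 => /eqP ->; rewrite mulr0.
have := ltn_expl `|p i j| (isT : (1 < 2)%N); rewrite {1}pij.
by case: `|r i j|%N pij => [->|w _]; rewrite ?muln0 // mulnS ltnNge leq_addr.
Qed.

(** * Root combinatorics *)

Section Dot.
Variables (F : rcfType) (l : nat).
Implicit Types u v w : 'rV[F]_l.

Lemma dotC u v : dot u v = dot v u.
Proof. by apply: eq_bigr => i _; rewrite mulrC. Qed.

Lemma dotDl u v w : dot (u + v) w = dot u w + dot v w.
Proof. by rewrite -big_split; apply: eq_bigr => i _; rewrite mxE mulrDl. Qed.

Lemma dotZl c u v : dot (c *: u) v = c * dot u v.
Proof. by rewrite mulr_sumr; apply: eq_bigr => i _; rewrite mxE mulrA. Qed.

Lemma dotDr u v w : dot u (v + w) = dot u v + dot u w.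
Proof. by rewrite dotC dotDl !(dotC u). Qed.

Lemma dotZr c u v : dot u (c *: v) = c * dot u v.
Proof. by rewrite dotC dotZl dotC. Qed.

Lemma dot_gt0 u : u != 0 -> 0 < dot u u.
Proof.
move=> u0; have dot_ge0 : 0 <= dot u u.
  by apply: sumr_ge0 => i _; rewrite -expr2 sqr_ge0.
rewrite lt_def dot_ge0 andbT; apply: contraNneq u0 => u0.
apply/eqP/rowP => i; rewrite mxE; apply/eqP; rewrite -sqrf_eq0 expr2.
have /psumr_eq0P/(_ u0 i isT) -> // : forall i, true -> 0 <= u 0 i * u 0 i.
by move=> j _; rewrite -expr2 sqr_ge0.
Qed.
End Dot.

(* In units of |g|^2, the form is the squared length of j d + k g when
   <g, d^vee> = -1 and <d, g^vee> = - c; m and n are the pairings of g and d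
   with the coroot of j d + k g. *)
Lemma binary_form_bound (c j k m n : int) :
  1 <= c <= 3 -> 1 <= j ->
  m * (c * j * j - c * j * k + k * k) = 2 * k - c * j ->
  n * (c * j * j - c * j * k + k * k) = 2 * c * j - c * k -> j <= 2.
Proof.
move=> c13 j1; set E := _ + k * k => mE nE.
set v := 2 * k - c * j in mE.
have E4 : 4 * E = v * v + (4 * c - c * c) * (j * j) by rewrite /E /v; ring.
have c3 : 3 <= 4 * c - c * c by nia.
(* If m = 0 then 2 k = c j, and the equation for n reduces to n j = 2. *)
have [m0|m0] := eqVneq m 0.
  have v0 : v = 0 by rewrite -mE m0 mul0r.
  have nj : n * j = 2.
    have : (4 * c - c * c) * j * (n * j) = (4 * c - c * c) * j * 2.
      have -> : (4 * c - c * c) * j * (n * j) = n * (4 * E).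
        by rewrite E4 v0; ring.
      have -> : n * (4 * E) = 4 * (n * E) by ring.
      rewrite nE; have : 2 * k = c * j by move: v0; rewrite /v; lia.
      move=> kc.
      have -> : 4 * (2 * c * j - c * k) = 8 * c * j - 2 * c * (2 * k) by ring.
      rewrite kc. ring.
    by apply: mulfI; rewrite mulf_neq0 //; lia.
  have n1 : 1 <= n by rewrite leNgt; apply/negP => n0; nia.
  nia.
(* Otherwise E <= |v|, and j >= 3 would give 4 |v| >= v^2 + 27, which is impossible. *)
have vE : E <= `|v|.
  rewrite -mE normrM; have : 1 <= `|m| by lia.
  have : 0 <= `|E| by []. have : E <= `|E| by rewrite ler_norm.
  nia.
have v2 : v * v = `|v| * `|v| by rewrite -normrM ger0_norm // -expr2 sqr_ge0.
have : 0 <= `|v| by [].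
rewrite v2 in E4; move: `|v| E4 vE => w wE Ew w0.
rewrite leNgt; apply/negP => j3; have : 27 <= (4 * c - c * c) * (j * j) by nia.
by move: wE; move: (_ * (j * j)) => K; nia.
Qed.

Section RootCombinatorics.
Variables (F : rcfType) (l : nat) (Phi : seq 'rV[F]_l).
Hypothesis Phi_root : root_system Phi.
Hypothesis Phi_red : reduced Phi.
Implicit Types a b g d : 'rV[F]_l.

Lemma root_nz a : a \in Phi -> a != 0.
Proof. by apply: contraTneq => ->; exact: root_neq0 Phi_root. Qed.

Lemma root_dot_gt0 a : a \in Phi -> 0 < dot a a.
Proof. by move/root_nz/dot_gt0. Qed.

Lemma root_opp a : a \in Phi -> - a \in Phi.
Proof.
move=> aPhi; have := root_reflection Phi_root aPhi aPhi.
by rewrite (pairing_self Phi_root) // scaler_nat mulr2n opprD addNKr.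
Qed.

Lemma root_oppE a : (- a \in Phi) = (a \in Phi).
Proof. by apply/idP/idP => /root_opp //; rewrite opprK. Qed.

Lemma pairingDl a b g : pairing (a + b) g = pairing a g + pairing b g.
Proof. by rewrite /pairing dotDl mulrDr mulrDl. Qed.

Lemma pairingZl (c : F) b g : pairing (c *: b) g = c * pairing b g.
Proof. by rewrite /pairing dotZl; ring. Qed.

Lemma pairingNl b g : pairing (- b) g = - pairing b g.
Proof. by rewrite -scaleN1r pairingZl mulN1r. Qed.

(* linear independence, for roots of a reduced system: see [nonprop_free] *)
Definition nonprop a b := (b != a) && (b != - a).

Lemma nonpropC a b : nonprop a b = nonprop b a.
Proof. by rewrite /nonprop eq_sym [_ == - _]eq_sym eqr_oppLR. Qed.

Section Pair.
Variables g d : 'rV[F]_l.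
Hypotheses (gPhi : g \in Phi) (dPhi : d \in Phi) (gd : nonprop g d).

Lemma nonprop_free (x y : F) : x *: d + y *: g = 0 -> x = 0 /\ y = 0.
Proof.
move=> xy0; have [x0|x0] := eqVneq x 0.
  move: xy0; rewrite x0 scale0r add0r => /eqP; rewrite scaler_eq0.
  by rewrite (negPf (root_nz gPhi)) orbF => /eqP.
have dE : d = (- y / x) *: g.
  apply: (scalerI x0); rewrite scalerA mulrC divfK // scaleNr.
  by apply/eqP; rewrite -addr_eq0 xy0.
case/andP: gd; have := Phi_red gPhi; move: dPhi; rewrite {1}dE => cg /(_ _ cg).
by case=> cE; rewrite dE cE ?scale1r ?scaleN1r eqxx.
Qed.

Lemma combo_neq0 j k : (0 < j)%N -> d *+ j + g *+ k != 0.
Proof.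
move=> j0; apply/eqP; rewrite -!scaler_nat => /nonprop_free[/eqP].
by rewrite pnatr_eq0 -leqn0 leqNgt j0.
Qed.

Lemma nonprop_combo j k : (0 < j)%N -> nonprop g (d *+ j + g *+ k).
Proof.
move=> j0; apply/andP; split; apply/eqP => E.
  have := @nonprop_free j%:R (k%:R - 1); rewrite scalerBl !scaler_nat scale1r.
  rewrite addrA E subrr => -[] // /eqP.
  by rewrite pnatr_eq0 -leqn0 leqNgt j0.
have := @nonprop_free j%:R (k%:R + 1); rewrite scalerDl !scaler_nat scale1r.
rewrite addrA E addNr => -[] // /eqP.
by rewrite pnatr_eq0 -leqn0 leqNgt j0.
Qed.

(** Strict Cauchy-Schwarz: v is |g|^2 times the component of d orthogonal to g, and its norm is
    positive. *)
Lemma dot_strict : dot g d ^+ 2 < dot g g * dot d d.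
Proof.
have G0 := root_dot_gt0 gPhi.
pose v := dot g g *: d + (- dot g d) *: g.
have v0 : v != 0.
  apply/eqP => /nonprop_free[/eqP]; rewrite gt_eqF //.
have := dot_gt0 v0; rewrite /v !(dotDl, dotDr, dotZl, dotZr) (dotC d g).
by move: (dot g g) (dot g d) (dot d d) G0 => G X D G0; nra.
Qed.

(** The product p q is 4 cos^2 of the angle, less than 4 by [dot_strict]; both integers have the
    sign of dot g d. *)
Lemma pairing_pair : exists p q : int,
  [/\ pairing g d = p%:~R, pairing d g = q%:~R, 0 <= p * q <= 3,
      (p < 0) = (q < 0) & (p == 0) = (q == 0)].
Proof.
have [p pE] := root_integral Phi_root dPhi gPhi.
have [q qE] := root_integral Phi_root gPhi dPhi.
have G0 := root_dot_gt0 gPhi; have D0 := root_dot_gt0 dPhi.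
have pD : p%:~R * dot d d = 2 * dot g d by rewrite -pE /pairing divfK ?gt_eqF.
have qG : q%:~R * dot g g = 2 * dot g d.
  by rewrite -qE /pairing divfK ?gt_eqF // dotC.
exists p, q; split=> //.
- have pq : (p * q)%:~R * (dot g g * dot d d) = 4 * dot g d ^+ 2 :> F.
    rewrite intrM (_ : 4 * _ = (2 * dot g d) * (2 * dot g d)); last by ring.
    by rewrite -{1}pD -qG; ring.
  have GD0 : 0 < dot g g * dot d d by rewrite mulr_gt0.
  rewrite -(ler0z F) -[p * q <= 3]ltzD1 -(ltr_int F).
  rewrite -(pmulr_lge0 _ GD0) -(ltr_pM2r GD0) pq.
  have := dot_strict; have := sqr_ge0 (dot g d); lra.
- rewrite -(ltrz0 F) -(ltrz0 F q) -(pmulr_llt0 _ D0).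
  by rewrite -(pmulr_llt0 q%:~R G0) pD qG.
- rewrite -(intr_eq0 F) -(intr_eq0 F q).
  rewrite -(mulIr_eq0 _ (mulIf (lt0r_neq0 D0))).
  by rewrite -(mulIr_eq0 q%:~R (mulIf (lt0r_neq0 G0))) pD qG.
Qed.

(** Let m and n be the pairings of g and d with the root eta, so that k m + j n = 2. If <g, d^vee>
    >= 0, then m >= 0 and n > 0, whence j <= 2; if it is -1, [binary_form_bound] applies. *)
Lemma combo_root_bound j k :
  - 1 <= pairing g d -> d *+ j + g *+ k \in Phi -> (j <= 2)%N.
Proof.
have [->//|j0] := posnP j.
have [p [q [pE qE pq3 pq_lt0 pq_eq0]]] := pairing_pair.
have G0 := root_dot_gt0 gPhi; have D0 := root_dot_gt0 dPhi.
rewrite pE -[-1]/((-1)%:~R) ler_int => p1 eta_root.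
have H0 := root_dot_gt0 eta_root.
have [m mE] := root_integral Phi_root eta_root gPhi.
have [n nE] := root_integral Phi_root eta_root dPhi.
set eta := _ + _ in eta_root H0 mE nE.
pose G := dot g g; pose D := dot d d; pose X := dot g d.
have HE : dot eta eta = j%:R ^+ 2 * D + 2 * j%:R * k%:R * X + k%:R ^+ 2 * G.
  rewrite /eta -!scaler_nat !(dotDl, dotDr, dotZl, dotZr) (dotC d g).
  by rewrite -/G -/D -/X; ring.
have mH : m%:~R * dot eta eta = 2 * (j%:R * X + k%:R * G).
  rewrite -mE /pairing divfK ?gt_eqF // /eta -!scaler_nat dotDr !dotZr.
  by rewrite -/G -/X.
have nH : n%:~R * dot eta eta = 2 * (j%:R * D + k%:R * X).
  rewrite -nE /pairing divfK ?gt_eqF // /eta -!scaler_nat dotDr !dotZr.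
  by rewrite (dotC d g) -/X -/D.
have pD : p%:~R * D = 2 * X by rewrite -pE /pairing divfK ?gt_eqF.
have qG : q%:~R * G = 2 * X by rewrite -qE /pairing divfK ?gt_eqF // dotC.
(* This is <eta, eta^vee> = 2. *)
have kj2 : k%:Z * m + j%:Z * n = 2.
  apply: (@intr_inj F); rewrite intrD !intrM /=.
  apply: (mulIf (lt0r_neq0 H0)); rewrite mulrDl -!mulrA mH nH HE.
  by rewrite -[k%:Z%:~R]/(k%:R) -[j%:Z%:~R]/(j%:R); ring.
have jR : 1 <= j%:R :> F by rewrite ler1n.
have kR : 0 <= k%:R :> F by [].
have [p0|p0] := leP 0 p.
  have X0 : 0 <= X.
    have : 0 <= p%:~R * D by rewrite mulr_ge0 ?ler0z // ltW.
    by rewrite pD; lra.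
  have n0 : 0 < n.
    rewrite -(ltr0z F) -(pmulr_lgt0 _ H0) nH; move: D0; rewrite -/D; nra.
  have m0 : 0 <= m.
    rewrite -(ler0z F) -(pmulr_lge0 _ H0) mH; move: G0; rewrite -/G; nra.
  by nia.
have p1E : p = -1 by lia.
(* c is the ratio |d|^2 / |g|^2. *)
pose c := - q.
have c13 : 1 <= c <= 3 by rewrite /c; nia.
have DE : D = c%:~R * G.
  by rewrite /c rmorphN mulNr qG -pD p1E mulrN1z mulN1r opprK.
have XE : 2 * X = - (c%:~R * G) by rewrite -pD p1E DE mulrN1z mulN1r.
suff : (j%:Z <= 2) by [].
apply: (@binary_form_bound c j%:Z k%:Z m n) => //.
- apply: (@intr_inj F); apply: (mulIf (lt0r_neq0 G0)).
  have -> : (2 * k%:Z - c * j%:Z)%:~R * G = m%:~R * dot eta eta.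
    have -> : m%:~R * dot eta eta = j%:R * (2 * X) + 2 * k%:R * G.
      by rewrite mH; ring.
    rewrite XE rmorphB !rmorphM /=.
    by rewrite -[k%:Z%:~R]/(k%:R) -[j%:Z%:~R]/(j%:R); ring.
  rewrite HE DE rmorphM rmorphD rmorphB !rmorphM /=.
  rewrite -[k%:Z%:~R]/(k%:R) -[j%:Z%:~R]/(j%:R).
  have -> : 2 * j%:R * k%:R * X = j%:R * k%:R * (2 * X) by ring.
  by rewrite -/G XE; ring.
- apply: (@intr_inj F); apply: (mulIf (lt0r_neq0 G0)).
  have -> : (2 * c * j%:Z - c * k%:Z)%:~R * G = n%:~R * dot eta eta.
    have -> : n%:~R * dot eta eta = 2 * j%:R * D + k%:R * (2 * X).
      by rewrite nH; ring.
    rewrite XE DE rmorphB !rmorphM /=.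
    by rewrite -[k%:Z%:~R]/(k%:R) -[j%:Z%:~R]/(j%:R); ring.
  rewrite HE DE rmorphM rmorphD rmorphB !rmorphM /=.
  rewrite -[k%:Z%:~R]/(k%:R) -[j%:Z%:~R]/(j%:R).
  have -> : 2 * j%:R * k%:R * X = j%:R * k%:R * (2 * X) by ring.
  by rewrite -/G XE; ring.
Qed.

Lemma pairing_bound : exists2 q : int, pairing d g = q%:~R & `|q| <= 3.
Proof.
have [p [q [_ qE pq3 _ pq0]]] := pairing_pair; exists q => //.
have [q0|q0] := eqVneq q 0; first by rewrite q0.
have p0 : p != 0 by rewrite pq0.
nia.
Qed.
End Pair.
End RootCombinatorics.

(** * Root strings *)

Section RootStrings.
Variables (F : rcfType) (l : nat) (Phi : seq 'rV[F]_l).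
Hypothesis Phi_root : root_system Phi.
Hypothesis Phi_red : reduced Phi.
Implicit Types a b g d : 'rV[F]_l.

Lemma nonpropNl a b : nonprop (- a) b = nonprop a b.
Proof. by rewrite /nonprop opprK andbC. Qed.

Lemma pairingNr a g : pairing a (- g) = - pairing a g.
Proof.
rewrite /pairing -scaleN1r !dotZr !dotZl !mulN1r opprK.
by rewrite mulrN mulNr.
Qed.

Lemma pairing_string a b k :
  a \in Phi -> pairing (b + a *+ k) a = pairing b a + (2 * k)%:R.
Proof.
move=> aPhi; rewrite pairingDl -scaler_nat pairingZl (pairing_self Phi_root) //.
by rewrite natrM mulrC.
Qed.

Lemma nonprop_string a b k : a \in Phi -> b \in Phi -> nonprop a b ->
  nonprop a (b + a *+ k).
Proof.
move=> aPhi bPhi ab.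
exact: (nonprop_combo Phi_root Phi_red aPhi bPhi ab k (isT : (0 < 1)%N)).
Qed.

(** k steps along a change the pairing with a by 2 k, and both pairings lie between -3 and 3. *)
Lemma string_length a b k : a \in Phi -> b \in Phi -> nonprop a b ->
  b + a *+ k \in Phi -> (k <= 3)%N.
Proof.
move=> aPhi bPhi ab bkPhi.
have [q qE q3] := pairing_bound Phi_root Phi_red aPhi bPhi ab.
have [r rE r3] := pairing_bound Phi_root Phi_red aPhi bkPhi
  (nonprop_string k aPhi bPhi ab).
have : r = q + (2 * k)%:Z.
  by apply: (@intr_inj F); rewrite -rE pairing_string // qE intrD -pmulrn.
lia.
Qed.

Lemma string_bottom a b : a \in Phi -> b \in Phi -> nonprop a b ->
  exists p, string_start Phi a b p.
Proof.
move=> aPhi bPhi ab.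
have ex0 : exists k, b - a *+ k \in Phi by exists 0%N; rewrite mulr0n subr0.
have bd k : b - a *+ k \in Phi -> (k <= 3)%N.
  rewrite -mulNrn => bk; apply: (string_length (a := - a) (b := b)) => //.
    exact: (root_opp Phi_root).
  by rewrite nonpropNl.
case: (ex_maxnP ex0 bd) => p pPhi pmax; exists p; split=> // k pk.
by apply/negP => /pmax; rewrite leqNgt pk.
Qed.

(** Two pairings that are at most -2 would have product at least 4. *)
Lemma good_pair g d : g \in Phi -> d \in Phi -> nonprop g d ->
  -1 <= pairing g d \/ -1 <= pairing d g.
Proof.
move=> gPhi dPhi gd.
have [p [q [-> -> pq3 pq_lt0 _]]] := pairing_pair Phi_root Phi_red gPhi dPhi gd.
rewrite -[-1]/((-1)%:~R) !ler_int.
by have [p1|p1] := leP (-1) p; [left | right; nia].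
Qed.

Hypothesis Phi_irr : irreducible Phi.
Hypothesis l_ge2 : (2 <= l)%N.

(** Otherwise the roots on the line of a are orthogonal to all others; irreducibility then puts
    every root on that line, against rank at least 2. *)
Lemma nonorthogonal_root a : a \in Phi ->
  exists g, [/\ g \in Phi, nonprop g a & 0 < pairing a g].
Proof.
move=> aPhi.
suff [g [gPhi ga ag0]] :
  exists g, [/\ g \in Phi, nonprop g a & pairing a g != 0].
  have [ag|ag|ag] := ltgtP (pairing a g) 0; last by rewrite ag eqxx in ag0.
    exists (- g); rewrite nonpropNl (root_opp Phi_root) //; split=> //.
    by rewrite pairingNr oppr_gt0.
  by exists g.
have [/hasP[g gPhi /andP[ga ag0]]|/hasPn none] :=
  boolP (has (fun g => nonprop g a && (pairing a g != 0)) Phi).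
  by exists g.
have orth b c : b \in Phi -> c \in Phi -> b \in <[a]>%VS -> c \notin <[a]>%VS ->
    dot b c = 0.
  move=> bPhi cPhi /vlineP[x ->] ca.
  have nca : nonprop c a.
    rewrite nonpropC; apply/andP; split; apply: contraNneq ca => ->.
      exact: memv_line.
    by rewrite memvN memv_line.
  have := none c cPhi.
  rewrite nca negbK /pairing !mulf_eq0 invr_eq0 pnatr_eq0 /=.
  rewrite (gt_eqF (root_dot_gt0 Phi_root cPhi)) orbF => /eqP ac.
  by rewrite dotZl ac mulr0.
case: (Phi_irr orth) => [allP|/(_ a aPhi)]; last by rewrite memv_line.
have : (<<Phi>> <= <[a]>)%VS by apply/span_subvP.
rewrite (root_span Phi_root) => /dimvS; rewrite dimvf dim_vline.
rewrite /dim /= mul1n => le1; move: (leq_trans l_ge2 le1).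
by case: (a != 0).
Qed.

(* d is the bottom of the g-string, or the roles are swapped when the bottom is
   shorter than the string direction. *)
Lemma root_decomposition a : a \in Phi -> exists g d k,
  [/\ [/\ g \in Phi, d \in Phi, nonprop g d & -1 <= pairing g d],
      (0 < k <= 3)%N, a = d + g *+ k,
      forall j, (j <= k)%N -> d + g *+ j \in Phi & string_start Phi g d 0].
Proof.
move=> aPhi; have [g [gPhi ga ag0]] := nonorthogonal_root aPhi.
have ex0 : exists k, a - g *+ k \in Phi by exists 0%N; rewrite mulr0n subr0.
have bd k : a - g *+ k \in Phi -> (k <= 3)%N.
  rewrite -mulNrn => bk; apply: (string_length (a := - g) (b := a)) => //.
    exact: (root_opp Phi_root).
  by rewrite nonpropNl.
case: (ex_maxnP ex0 bd) => k bPhi kmax; set b := a - g *+ k in bPhi.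
have bottom j : (0 < j)%N -> b - g *+ j \notin Phi.
  move=> j0; apply/negP; rewrite /b -addrA -opprD -mulrnDr => /kmax.
  by rewrite -{2}[k]addn0 leq_add2l leqNgt j0.
have aE : a = b + g *+ k by rewrite /b subrK.
have gb : nonprop g b.
  rewrite /b -mulNrn -nonpropNl; apply: nonprop_string => //.
    exact: (root_opp Phi_root).
  by rewrite nonpropNl.
have [p [q [pE qE pq3 pq_lt0 pq_eq0]]] :=
  pairing_pair Phi_root Phi_red gPhi bPhi gb.
have refl_b : b - g *~ q \in Phi.
  by have := root_reflection Phi_root gPhi bPhi; rewrite qE scaler_int.
have refl_a : b + g *+ k - g *~ (q + (2 * k)%:Z) \in Phi.
  have := root_reflection Phi_root gPhi aPhi.
  by rewrite aE pairing_string // qE [(2 * k)%:R]pmulrn -intrD scaler_int.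
have agE : 0 < q + (2 * k)%:Z.
  by rewrite -(ltr0z F) intrD -pmulrn -qE -pairing_string // -aE.
(* Otherwise a reflection in g leads below the bottom b: that of a to b - k g if q = 0, that of b to
   b - q g if q > 0. *)
have q0 : q < 0.
  rewrite ltNge; apply/negP => q0; have [qz|q1] := eqVneq q 0.
    have k0 : (0 < k)%N by move: agE; rewrite qz; clear; lia.
    have /negP[] := bottom _ k0.
    move: refl_a; rewrite qz add0r mul2n -addnn PoszD mulrzDr -!pmulrn.
    by rewrite opprD addrA addrK.
  move: q1; rewrite -absz_gt0 => /bottom/negP[].
  by rewrite pmulrn gez0_abs.
have [c qc] : exists c : nat, q = - c%:Z.
  by exists `|q|%N; rewrite ltz0_abs // opprK.
have c13 : (0 < c <= 3)%N by move: q0 pq3 pq_lt0; rewrite qc; clear; nia.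
(* The reflection of a in g is b + (c - k) g, and no root of the string lies below b. *)
have kc : (k <= c)%N.
  rewrite leqNgt; apply/negP; rewrite -subn_gt0 => ck.
  have /negP[] := bottom _ ck.
  move: refl_a; rewrite -addrA pmulrn -mulrzBr.
  have -> : k%:Z - (q + (2 * k)%:Z) = - (k - c)%N%:Z.
    by move: ck; rewrite subn_gt0 qc; clear; lia.
  by rewrite mulrNz -pmulrn.
have k0 : (0 < k)%N by move: agE q0; clear; lia.
have top : b + g *+ c \in Phi by move: refl_b; rewrite qc mulrNz opprK -pmulrn.
have [p1|p1] := eqVneq p (-1).
  exists g, b, k; split=> //.
  4: by split=> [|j /bottom]; rewrite ?mulr0n ?subr0.
  - by split=> //; rewrite pE p1.
  - by rewrite k0 (leq_trans kc) //; case/andP: c13.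
  have b1 : b + g *+ 1 \in Phi.
    have := root_reflection Phi_root bPhi gPhi.
    by rewrite pE p1 scaleN1r opprK addrC.
  have bc1 : b + g *+ c.-1 \in Phi.
    have := root_reflection Phi_root gPhi b1.
    rewrite pairing_string // qE qc [(2 * 1)%:R]pmulrn -intrD scaler_int.
    rewrite -addrA [g *+ 1]pmulrn -mulrzBr.
    have -> : 1%:Z - (- c%:Z + 2) = (c.-1)%:Z by move: c13; clear; lia.
    by rewrite -pmulrn.
  (* As c <= 3, these four values exhaust the range from 0 to c. *)
  move=> j jk; have : j \in [:: 0; 1; c.-1; c]%N.
    by rewrite !inE; move: jk kc c13; clear; lia.
  by rewrite !inE => /or4P[] /eqP -> //; rewrite mulr0n addr0.
(* Here p <= -2, which forces q = -1; so a = b + g, and b and g exchange roles. *)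
have c1 : c = 1%N by move: q0 pq3 pq_lt0 p1; rewrite qc; clear; nia.
have k1 : k = 1%N by move: k0 kc; rewrite c1; clear; lia.
rewrite k1 mulr1n in aE; exists b, g, 1%N; split=> //.
- by split; rewrite 1?nonpropC // qE qc c1.
- by rewrite aE addrC.
- by case=> [_|[_|//]]; rewrite ?mulr0n ?addr0 // mulr1n addrC -aE.
(* g - b is no root because b - g lies below b. For g - (j + 2) b the pairing with - b would be - p
   + 2 (j + 2), above 3. *)
split=> [|[//|[_|j _]]]; first by rewrite mulr0n subr0.
  rewrite mulr1n -opprB (root_oppE Phi_root).
  by have := bottom 1%N isT; rewrite mulr1n.
apply/negP; rewrite -mulNrn => gj.
have Nb := root_opp Phi_root bPhi.
have bg : nonprop (- b) g by rewrite nonpropNl nonpropC.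
have [r rE r3] :=
  pairing_bound Phi_root Phi_red Nb gj (nonprop_string _ Nb gPhi bg).
have Nbg : pairing g (- b) = (- p)%:~R.
  by rewrite pairingNr pE rmorphN.
have r_eq : r = - p + (2 * j.+2)%:Z.
  by apply: (@intr_inj F); rewrite -rE pairing_string // Nbg intrD -pmulrn.
have p0 : p < 0 by rewrite pq_lt0.
by move: r_eq r3 p0; clear; lia.
Qed.
End RootStrings.

(** * The commutator formula *)

Lemma lieZZ (c c' : int) n (X Y : 'M[int]_n) :
  lie (c *: X) (c' *: Y) = (c * c') *: lie X Y.
Proof.
case: n X Y => [|n] X Y; first by rewrite [LHS]thinmx0 [RHS]thinmx0.
by rewrite /lie -!scalerAl -!scalerAr !scalerA [c' * c]mulrC -scalerBr.
Qed.

Section Monomials.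
Variable A : nzRingType.
Implicit Types x y : A.

Lemma lie_monomial x y i j :
  lie (x%:P * 'X^i) (y%:P * 'X^j) = (lie x y)%:P * 'X^(i + j).
Proof.
rewrite /lie polyCB mulrBl !polyCM; congr (_ - _).
  by rewrite -!mulrA exprD; congr (_ * _); rewrite !mulrA -commr_polyXn.
by rewrite -!mulrA addnC exprD; congr (_ * _); rewrite !mulrA -commr_polyXn.
Qed.

Lemma divided_monomial N x D k : divided N x D ->
  divided N (x%:P * 'X^k) (fun m => (D m)%:P * 'X^(k * m)).
Proof.
move=> [D0 DS DN]; split=> [|m|m Nm].
- by rewrite D0 muln0 mulr1.
- rewrite -mulrA (mulrA 'X^k) -commr_polyXn -mulrA -exprD addnC -mulnSr mulrA.
  by rewrite -polyCM DS polyCMn mulrnAl.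
- by rewrite DN // mul0r.
Qed.
End Monomials.

(** The conditional hypothesis allows X to be a value of [e] outside Phi, provided that its
    coefficient is 0. *)
Lemma divided_scale N n (c : int) (X : 'M[int]_n.+1) D :
  (0 < N)%N -> D 0%N = 1 ->
  (c != 0 -> divided N X D) -> divided N (c *: X) (fun m => c ^+ m *: D m).
Proof.
move=> N0 D0 hD; split=> [|m|m Nm]; first by rewrite D0 expr0 scale1r.
  have [->|/hD[_ DS _]] := eqVneq c 0.
    by rewrite exprS mul0r !scale0r mul0r mul0rn.
  by rewrite -scalerAl -scalerAr scalerA -exprS DS scalerMnr.
have [->|/hD[_ _ DN]] := eqVneq c 0; last by rewrite DN // scaler0.
by rewrite expr0n gtn_eqF ?scale0r // (leq_trans N0).
Qed.

(** * Root vectors and their structure constants *)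

Section Formula.
Variables (F : rcfType) (l : nat) (Phi : seq 'rV[F]_l).
Hypothesis Phi_root : root_system Phi.
Hypothesis Phi_red : reduced Phi.
Variables (n : nat) (e : 'rV[F]_l -> 'M[int]_n.+1).
Hypothesis Phi_chev : chevalley_module Phi e.

Lemma divided_root a : a \in Phi -> divided n.+1 (e a) (divpow (e a)).
Proof.
move=> aPhi; have dv m : forall i j, (m`! %| (e a ^+ m) i j)%Z.
  exact: (chev_admissible Phi_chev).
have nil := chev_nilpotent Phi_root Phi_chev aPhi.
split=> [|m|m]; first exact: (divpow0 dv).
  have e1 : divpow (e a) 1 = e a.
    by have := divpowE dv 1; rewrite (_ : 1`!%:Z = 1) // scale1r expr1.
  rewrite -{1}e1; have := divpowM dv 1 m.
  by rewrite /GRing.mul /= => ->; rewrite add1n bin1 -scaler_nat natz.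
exact: divpow_eq0.
Qed.

Lemma divpow_0 (X : 'M[int]_n.+1) : divpow X 0 = 1.
Proof. by apply/matrixP => i j; rewrite mxE expr0 fact0 divz1. Qed.

Lemma expmx_at0 (R : comPzRingType) (X : 'M[int]_n.+1) : expmx X (0 : R) = 1%:M.
Proof.
rewrite /expmx big_ord_recl expr0 scale1r big1 ?addr0 => [|i _].
  by rewrite divpow_0 map_mx1.
by rewrite exprS mul0r scale0r.
Qed.

Lemma root_vector_not_even a : a \in Phi -> ~ even_mx (e a).
Proof.
move=> aPhi; have NaPhi := root_opp Phi_root aPhi.
have pa : pairing a a = 2%:~R by rewrite (pairing_self Phi_root).
have pNa : pairing (- a) a = (-2)%:~R.
  by rewrite pairingNl pa -rmorphN.
apply: (root_vector_odd (y := e (- a))).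
- exact: (chev_cartan Phi_chev).
- by rewrite (chev_cartan Phi_chev aPhi NaPhi pNa) scaleNr.
- by move=> m; exact: (chev_admissible Phi_chev).
- by move=> m; exact: (chev_admissible Phi_chev).
- exact: (chev_neq0 Phi_chev).
Qed.

Lemma lie_roots a b : a \in Phi -> b \in Phi -> a + b != 0 ->
  exists N : int,
    lie (e a) (e b) = N *: e (a + b) /\ (a + b \notin Phi -> N = 0).
Proof.
move=> aPhi bPhi ab0; have [abPhi|abPhi] := boolP (a + b \in Phi); last first.
  by exists 0; rewrite scale0r (chev_nonroot Phi_chev).
have [ba|ba] := eqVneq b a.
  by exists 0; rewrite ba /lie subrr scale0r.
have nab : nonprop a b.
  by rewrite /nonprop ba /=; apply: contraNneq ab0 => ->; rewrite subrr.
have [p sp] := string_bottom Phi_root Phi_red aPhi bPhi nab.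
case: (chev_root Phi_chev aPhi bPhi abPhi sp) => ->; last by exists (- p.+1%:Z).
by exists p.+1%:Z.
Qed.

Section Pair.
Variables g d : 'rV[F]_l.
Hypotheses (gPhi : g \in Phi) (dPhi : d \in Phi) (gd : nonprop g d).

(* c k = +- 'C(p + k, k), where p is the length of the string below d, and
   c k *: e (d + k g) is the k-th divided power of ad (e g) applied to e d. *)
Lemma string_coefs : exists c : nat -> int,
  [/\ c 0%N = 1,
      forall k, lie (e g) (c k *: e (d + g *+ k)) =
        c k.+1 *: e (d + g *+ k.+1) *+ k.+1,
      forall k, d + g *+ k \notin Phi -> c k = 0
    & string_start Phi g d 0 ->
      forall k, (forall j, (j <= k)%N -> d + g *+ j \in Phi) ->
        c k = 1 \/ c k = -1].
Proof.
have [p sp] := string_bottom Phi_root Phi_red gPhi dPhi gd.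
pose x k := d + g *+ k.
(* [ok k] asks for all of d, ..., d + k g to be roots; c vanishes from the first gap on. *)
pose ok k := all (fun j => x j \in Phi) (iota 0 k.+1).
(* The sign that [chev_root] leaves open, read off by comparing matrices. *)
pose sg k : int := (-1) ^+ (lie (e g) (e (x k)) != (p + k).+1%:Z *: e (x k.+1)).
pose c k := if ok k then \prod_(i < k) sg i * 'C(p + k, k)%:Z else 0.
have okS k : ok k.+1 = ok k && (x k.+1 \in Phi).
  by rewrite /ok -[k.+2]addn1 iotaD all_cat add0n /= andbT.
have okx k : ok k -> x k \in Phi.
  by case: k => [|k]; [rewrite /ok /= andbT | rewrite okS => /andP[]].
have xS k : g + x k = x k.+1 by rewrite /x mulrS addrCA.
have sgP k : ok k.+1 ->
    lie (e g) (e (x k)) = (sg k * (p + k).+1%:Z) *: e (x k.+1).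
  move=> okk; have okk1 := okx _ okk.
  move: (okk); rewrite okS => /andP[/okx okk0 _].
  (* The bottom of the string is p + k steps below d + k g. *)
  have spk : string_start Phi g (x k) (p + k).
    case: sp => s0 s1; split=> [|j pj].
      by rewrite /x mulrnDr opprD addrACA subrr addr0.
    have kj : (k <= j)%N by lia.
    have gj : g *+ j = g *+ (j - k) + g *+ k by rewrite -mulrnDr subnK.
    by rewrite gj /x opprD addrACA subrr addr0; apply: s1; lia.
  have := chev_root Phi_chev gPhi okk0; rewrite xS => /(_ _ okk1 spk).
  rewrite /sg; case: eqP => [-> _|_ [//|->]]; first by rewrite expr0 mul1r.
  by rewrite expr1 mulN1r.
exists c; rewrite -/x; split.
- by rewrite /c /ok /= /x mulr0n addr0 dPhi big_ord0 addn0 bin0.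
- move=> k; rewrite -/(x k) -/(x k.+1) /c okS.
  have [okk|] := boolP (ok k); last by rewrite !scale0r lie0r mul0rn.
  have [x1|x1] /= := boolP (x k.+1 \in Phi); last first.
    rewrite scale0r mul0rn -[e g]scale1r lieZZ mul1r.
    rewrite (chev_nonroot Phi_chev gPhi (okx _ okk)) ?xS ?scaler0 //.
    have := combo_neq0 Phi_root Phi_red gPhi dPhi gd k.+1 (isT : (0 < 1)%N).
    by rewrite mulr1n.
  rewrite -[e g]scale1r lieZZ mul1r sgP ?okS ?okk //.
  rewrite scalerA -scaler_nat scalerA.
  have binE : 'C(p + k, k)%:Z * (p + k).+1%:Z = k.+1%:Z * 'C(p + k.+1, k.+1)%:Z.
    by rewrite -!PoszM addnS -mul_bin_diag mulnC.
  congr (_ *: _); rewrite big_ord_recr /= natz; set w := \prod_(i < k) _.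
  transitivity (w * sg k * ('C(p + k, k)%:Z * (p + k).+1%:Z)); first by ring.
  by rewrite binE; ring.
- move=> k xk; rewrite /c; case: ifP => // /okx; rewrite -/(x k) in xk.
  by rewrite (negPf xk).
(* With p = 0 the binomial is 'C(k, k) = 1, and only signs remain. *)
- move=> sp0 k xk; have p0 : p = 0%N.
    apply/eqP; rewrite -leqn0 leqNgt; apply/negP => p0.
    by case: sp0 => _ /(_ p p0); case: sp => ->.
  have okk : ok k by apply/allP => j; rewrite mem_iota add0n ltnS => /xk.
  rewrite /c okk p0 add0n binn mulr1.
  elim: {xk okk} k => [|k IH]; first by rewrite big_ord0; left.
  have sgE : sg k = 1 \/ sg k = -1.
    by rewrite /sg; case: (_ != _); [right | left].
  by rewrite big_ord_recr /=; case: IH => ->; case: sgE => ->;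
    rewrite ?mulN1r ?mul1r ?opprK; [left | right | right | left].
Qed.
End Pair.
End Formula.

(** For i before j, Y_i Y_j + Y_j Y_i = 2 Y_i Y_j - [Y_i, Y_j]; the squares are even by
    hypothesis. *)
Lemma sqr_sum_brackets (A : nzRingType) (Y : nat -> A) (D : nat -> A) ks :
  (forall k, Y k * Y k = D k *+ 2) ->
  exists Q,
    (\sum_(k <- ks) Y k) * (\sum_(k <- ks) Y k) = Q *+ 2 - brackets Y ks.
Proof.
move=> YD; elim: ks => [|k ks [Q IH]] /=.
  by exists 0; rewrite big_nil mul0r mul0rn subrr.
rewrite big_cons; set S := \sum_(j <- ks) Y j in IH *.
exists (D k + Q + Y k * S).
rewrite mulrDl !mulrDr IH YD /lie !mulrnDl.
move: (Y k * S) (S * Y k) (brackets Y ks) (D k *+ 2) (Q *+ 2) => P P' b D2 Q2.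
rewrite -[RHS]addrA.
have -> : P *+ 2 - (P - P' + b) = P + (P' - b).
  by rewrite mulr2n opprD opprB [P' - P]addrC !addrA addrK.
rewrite -!addrA; congr (_ + _); rewrite [RHS]addrCA; congr (_ + _).
by rewrite addrCA.
Qed.

(** The sum of the Y k is u x v, so its square u x^2 v is even; compare with [sqr_sum_brackets]. *)
Lemma brackets_even_of_conj (A : nzRingType) (Y D : nat -> A) ks u v x x2 :
  (forall k, Y k * Y k = D k *+ 2) -> x * x = x2 *+ 2 ->
  u * v = 1 -> u * x = (\sum_(k <- ks) Y k) * u ->
  exists T, - brackets Y ks = T *+ 2.
Proof.
move=> YD xx uv ux; have [Q QE] := sqr_sum_brackets ks YD.
exists (u * x2 * v - Q); rewrite mulrnBl -mulrnAl -mulrnAr -xx mulrA ux.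
by rewrite -[_ * u * x]mulrA ux mulrA -mulrA uv mulr1 QE addrAC subrr add0r.
Qed.

(** * The generic commutator formula over Z[s][t] *)

Section Formula.
Variables (F : rcfType) (l : nat) (Phi : seq 'rV[F]_l).
Hypothesis Phi_root : root_system Phi.
Hypothesis Phi_red : reduced Phi.
Variables (n : nat) (e : 'rV[F]_l -> 'M[int]_n.+1).
Hypothesis Phi_chev : chevalley_module Phi e.
Variables g d : 'rV[F]_l.
Hypotheses (gPhi : g \in Phi) (dPhi : d \in Phi) (gd : nonprop g d).
Hypothesis gd_good : -1 <= pairing g d.

Let neq0 j k : (0 < j)%N -> d *+ j + g *+ k != 0.
Proof. exact: (combo_neq0 Phi_root Phi_red gPhi dPhi gd). Qed.

(** The sum of the two roots has d-coefficient above 2, so it is no root by [combo_root_bound]. *)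
Lemma lie_far j j' k k' : (0 < j)%N -> (2 < j + j')%N ->
  d *+ j + g *+ k \in Phi -> d *+ j' + g *+ k' \in Phi ->
  lie (e (d *+ j + g *+ k)) (e (d *+ j' + g *+ k')) = 0.
Proof.
move=> j0 jj r1 r2; have E : d *+ j + g *+ k + (d *+ j' + g *+ k') =
    d *+ (j + j') + g *+ (k + k') by rewrite !mulrnDr addrACA.
apply: (chev_nonroot Phi_chev); rewrite ?E ?neq0 ?addn_gt0 ?j0 //.
by apply/negP => /(combo_root_bound Phi_root Phi_red gPhi dPhi gd gd_good); lia.
Qed.

Variable c : nat -> int.
Hypothesis c0 : c 0%N = 1.
Hypothesis cS : forall k,
  lie (e g) (c k *: e (d + g *+ k)) = c k.+1 *: e (d + g *+ k.+1) *+ k.+1.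
Hypothesis c_nonroot : forall k, d + g *+ k \notin Phi -> c k = 0.

Let c4 : c 4 = 0.
Proof.
apply: c_nonroot; apply/negP => /(string_length Phi_root Phi_red gPhi dPhi gd).
by [].
Qed.

Let tf0 : torsion_free 'M[int]_n.+1 := @torsion_free_mx _ _.
Let tf1 := torsion_free_poly tf0.

(* the indeterminate of these polynomials is s, the parameter of x_g *)
Definition monoX (i : int) (X : 'M[int]_n.+1) k : {poly 'M[int]_n.+1} :=
  (i *: X)%:P * 'X^k.
Definition monoD (i : int) (X : 'M[int]_n.+1) k m : {poly 'M[int]_n.+1} :=
  (i ^+ m *: divpow X m)%:P * 'X^(k * m).

Lemma divided_mono i b k : (b \notin Phi -> i = 0) ->
  divided n.+1 (monoX i (e b) k) (monoD i (e b) k).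
Proof.
move=> bi; apply: divided_monomial; apply: divided_scale => //.
  exact: divpow_0.
move=> i0; apply: (divided_root Phi_root Phi_chev).
by apply: contraNT i0 => /bi ->.
Qed.

Let Y k := monoX (c k) (e (d + g *+ k)) k.
Let DY k := monoD (c k) (e (d + g *+ k)) k.
(** No d + k g with k > 3 is a root. The decreasing order puts exp (t e_d), the factor for k = 0,
    last, next to x_g(s). *)
Let ks : seq nat := [:: 3; 2; 1; 0]%N.
Let Ysum := \sum_(k <- ks) Y k.
Let Eg := expp n.+1 (divpow (e g)) 1.

Let hDY k : divided n.+1 (Y k) (DY k).
Proof. exact/divided_mono/c_nonroot. Qed.

Let hDg := divided_root Phi_root Phi_chev gPhi.
Let hDd := divided_root Phi_root Phi_chev dPhi.

Let dEg : Eg^`() = (e g)%:P * Eg.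
Proof. by rewrite (deriv_expp hDg) expr0 mulr1. Qed.

Let Y4 : Y 4 = 0.
Proof. by rewrite /Y /monoX c4 scale0r mul0r. Qed.

Let dY k : (Y k.+1)^`() = lie (e g)%:P (Y k).
Proof.
have -> : (e g)%:P = (e g)%:P * 'X^0 :> {poly 'M[int]_n.+1}.
  by rewrite expr0 mulr1.
rewrite lie_monomial cS add0n derivM derivC mul0r add0r derivXn /=.
by rewrite polyCMn mulrnAl -mulrnAr.
Qed.

Let dY0 : (Y 0)^`() = 0.
Proof. by rewrite /Y /monoX expr0 mulr1 derivC. Qed.

(** As functions of s, both sides solve U' = e_g U with initial value e_d, because Y_(k+1)' =
    [e_g, Y_k] and Y_4 = 0. *)
Lemma conj_root_vector : Eg * (e d)%:P = Ysum * Eg.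
Proof.
apply: (ode_unique tf0 (L := (e g)%:P)).
- by rewrite derivM derivC mulr0 addr0 dEg mulrA.
- have dYsum : Ysum^`() = lie (e g)%:P Ysum.
    rewrite /Ysum lie_sumr !big_cons !big_nil !derivD dY0 deriv0 !dY !addr0.
    by rewrite -(dY 3) Y4 deriv0 add0r.
  by rewrite derivM dEg dYsum /lie mulrBl -!mulrA subrK.
- rewrite coefMC /Eg (coef0_expp hDg) mul1r coef0M (coef0_expp hDg) mulr1.
  rewrite /Ysum !big_cons big_nil !coefD /Y /monoX !coefMXn /= !add0r.
  by rewrite coefC coef0 addr0 c0 scale1r mulr0n addr0.
Qed.

Let Egi := expp n.+1 (fun m => (-1) ^+ m *: divpow (e g) m) 1.

Lemma Eg_unit : Eg * Egi = 1.
Proof.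
have hN : divided n.+1 (- 1 *: e g) (fun m => (-1) ^+ m *: divpow (e g) m).
  by apply: divided_scale => //; exact: divpow_0.
apply: (ode_unique tf0 (L := 0)).
- have gg : lie (e g) (e g) = 0 by rewrite /lie subrr.
  rewrite derivM dEg (deriv_expp hN) expr0 mulr1 mul0r mulr1n scaleN1r polyCN.
  by rewrite (expp_comm tf0 hDg 1 gg) mulNr mulrN mulrA subrr.
- by rewrite derivC mul0r.
- by rewrite coef0M (coef0_expp hDg) (coef0_expp hN) coef1 mulr1.
Qed.

Lemma brackets_even : exists T, - brackets Y ks = T *+ 2.
Proof.
have Y2 k : Y k * Y k = DY k 2 *+ 2.
  have D1 : DY k 1 = Y k.
    by have := dividedS (hDY k) 0; rewrite (divided0 (hDY k)) mulr1.
  by have := dividedS (hDY k) 1; rewrite D1.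
have d2 : (e d)%:P * (e d)%:P = (divpow (e d) 2)%:P *+ 2 :> {poly 'M[int]_n.+1}.
  have d1 : divpow (e d) 1 = e d.
    by have := dividedS hDd 0; rewrite (divided0 hDd) mulr1.
  by have := dividedS hDd 1; rewrite d1 -polyCM -polyCMn => ->.
exact: (brackets_even_of_conj Y2 d2 Eg_unit conj_root_vector).
Qed.

(** A bracket [Y_i, Y_j] has weight 2 d + (i + j) g, so at s^r only the root vector of 2 d + r g can
    occur. *)
Let deg2 r (Z : {poly 'M[int]_n.+1}) := exists2 N : int,
  Z`_r = N *: e (d *+ 2 + g *+ r) & d *+ 2 + g *+ r \notin Phi -> N = 0.

Lemma deg2D r Z1 Z2 : deg2 r Z1 -> deg2 r Z2 -> deg2 r (Z1 + Z2).
Proof.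
move=> [N1 E1 H1] [N2 E2 H2]; exists (N1 + N2) => [|nr].
  by rewrite coefD E1 E2 scalerDl.
by rewrite H1 // H2.
Qed.

Lemma deg2_0 r : deg2 r 0.
Proof. by exists 0; [rewrite coef0 scale0r | ]. Qed.

Lemma deg2_lie r i j : deg2 r (lie (Y i) (Y j)).
Proof.
rewrite /Y lie_monomial lieZZ.
have [ijr|ijr] := eqVneq r (i + j)%N; last first.
  exists 0; last by [].
  rewrite scale0r coefMXn; case: ltnP => ijr'; first by [].
  by rewrite coefC subn_eq0 leqNgt ltn_neqAle eq_sym ijr ijr'.
have Er (Z : 'M[int]_n.+1) : (Z%:P * 'X^(i + j))`_r = Z.
  by rewrite coefMXn ijr ltnn subnn coefC eqxx.
have [xi|/c_nonroot ci] := boolP (d + g *+ i \in Phi); last first.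
  by exists 0; [rewrite Er ci mul0r !scale0r | ].
have [xj|/c_nonroot cj] := boolP (d + g *+ j \in Phi); last first.
  by exists 0; [rewrite Er cj mulr0 !scale0r | ].
have sE : d + g *+ i + (d + g *+ j) = d *+ 2 + g *+ r.
  by rewrite ijr addrACA -mulr2n -mulrnDr.
have [|N [NE N0]] := lie_roots Phi_root Phi_red Phi_chev xi xj.
  by rewrite sE neq0.
exists (c i * c j * N); first by rewrite Er NE sE scalerA.
by rewrite -sE => /N0 ->; rewrite mulr0.
Qed.

Lemma deg2_brackets r ks' : deg2 r (brackets Y ks').
Proof.
elim: ks' => [|k ks' IH] /=; first exact: deg2_0.
apply: deg2D => //; rewrite lie_sumr.
apply: (big_ind (deg2 r)) => [|Z1 Z2|i _].
- exact: deg2_0.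
- exact: deg2D.
- exact: deg2_lie.
Qed.

(* The coefficients of T = - brackets / 2 are multiples of root vectors by half
   integers; an odd numerator would make the root vector even. *)
Lemma central_terms : exists (dd : nat -> int) (m : nat),
  (forall r, d *+ 2 + g *+ r \notin Phi -> dd r = 0) /\
  (\sum_(r <- iota 0 m) monoX (dd r) (e (d *+ 2 + g *+ r)) r) *+ 2 =
    - brackets Y ks.
Proof.
have [T TE] := brackets_even.
(* The conditions on N are boolean so that [xchoose] can select the integers. *)
have hT r : exists N : int, (T`_r == N *: e (d *+ 2 + g *+ r)) &&
    ((d *+ 2 + g *+ r \in Phi) || (N == 0)).
  have [N NE N0] := deg2_brackets r ks.
  have T2 : T`_r *+ 2 = - N *: e (d *+ 2 + g *+ r).
    by rewrite -coefMn -TE coefN NE scaleNr.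
  have [rPhi|/N0 N00] /= := boolP (_ \in Phi); last first.
    exists 0; rewrite eqxx scale0r andbT; apply/eqP/(tf0 (m := 1)).
    by rewrite T2 N00 oppr0 scale0r.
  have [k kE] : exists k : int, - N = 2 * k \/ - N = 2 * k + 1.
    by exists ((- N) %/ 2)%Z; lia.
  exists k; rewrite andbT; case: kE => kE.
    apply/eqP/(mulrnI tf0 (m := 1)); rewrite T2 kE -scalerA.
    by rewrite -[RHS]scaler_nat natz.
  case: (root_vector_not_even Phi_root Phi_chev rPhi).
  exists (T`_r - k *: e (d *+ 2 + g *+ r)).
  rewrite scalerBr -[2 *: T`_r]/(2%:Z *: _) -[2%:Z]natz scaler_nat T2 kE.
  move: (e (d *+ 2 + g *+ r)) => X.
  by rewrite natz scalerA scalerDl scale1r addrC addKr.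
pose dd r := xchoose (hT r).
have ddP r : T`_r = dd r *: e (d *+ 2 + g *+ r) /\
    (d *+ 2 + g *+ r \notin Phi -> dd r = 0).
  have /andP[/eqP TrE /orP ddr] := xchooseP (hT r).
  split=> [|nr]; first exact: TrE.
  by case: ddr => [rPhi|/eqP //]; rewrite rPhi in nr.
exists dd, (size T); split=> [r|]; first by case: (ddP r).
rewrite TE; congr (_ *+ 2); rewrite -[RHS]coefK poly_def -val_enum_ord big_map.
rewrite big_enum /=; apply: eq_bigr => r _.
by rewrite -mul_polyC (ddP r).1.
Qed.

Let Ed : {poly {poly 'M[int]_n.+1}} :=
  expp n.+1 (fun m => (divpow (e d) m)%:P) 1.

(* The inner indeterminate is s, the outer one is t. *)
Lemma commutator_formula_generic : exists (dd : nat -> int) (m : nat),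
  (forall r, d *+ 2 + g *+ r \notin Phi -> dd r = 0) /\
  Eg%:P * Ed =
  \prod_(r <- iota 0 m) expp n.+1 (monoD (dd r) (e (d *+ 2 + g *+ r)) r) 2 *
  \prod_(k <- ks) expp n.+1 (DY k) 1 * Eg%:P.
Proof.
have [dd [m [dd0 WE]]] := central_terms; exists dd, m; split=> //.
pose W r := monoX (dd r) (e (d *+ 2 + g *+ r)) r.
have hDW r : divided n.+1 (W r) (monoD (dd r) (e (d *+ 2 + g *+ r)) r).
  exact/divided_mono/dd0.
(* Terms of total degree above 2 in d commute, which gives all the vanishing brackets that
   [zassenhaus] requires. *)
have far j j' i i' k k' : (0 < j)%N -> (2 < j + j')%N ->
    (d *+ j + g *+ k \notin Phi -> i = 0) ->
    (d *+ j' + g *+ k' \notin Phi -> i' = 0) ->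
    lie (monoX i (e (d *+ j + g *+ k)) k)
      (monoX i' (e (d *+ j' + g *+ k')) k') = 0.
  move=> j0 jj iP i'P; rewrite lie_monomial lieZZ.
  have [r1|/iP ->] := boolP (d *+ j + g *+ k \in Phi); last first.
    by rewrite mul0r scale0r mul0r.
  have [r2|/i'P ->] := boolP (d *+ j' + g *+ k' \in Phi); last first.
    by rewrite mulr0 scale0r mul0r.
  by rewrite lie_far // scaler0 mul0r.
have YE k : Y k = monoX (c k) (e (d *+ 1 + g *+ k)) k by [].
have WW i j : lie (W i) (W j) = 0 by apply: far => //; exact: dd0.
have WY i j : lie (W i) (Y j) = 0.
  by rewrite YE; apply: far => //; [exact: dd0|exact: c_nonroot].
have YYY i j k : lie (Y i) (lie (Y j) (Y k)) = 0.
  have [N NE N0] := deg2_lie (j + k) j k.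
  have -> : lie (Y j) (Y k) = monoX N (e (d *+ 2 + g *+ (j + k))) (j + k).
    rewrite /monoX -NE /Y lie_monomial; congr (_ * _); congr (_%:P).
    by rewrite coefMXn ltnn subnn coefC.
  by rewrite YE; apply: far => //; exact: c_nonroot.
have [dV V0] := zassenhaus tf1 hDY hDW YYY WY WW WE.
(* In t, both sides solve U' = Ysum U with initial value Eg, the left one by [conj_root_vector]. *)
apply: (ode_unique tf1 (L := Ysum%:P)).
- have hDd' : divided n.+1 (e d)%:P
      (fun m => (divpow (e d) m)%:P : {poly 'M[int]_n.+1}).
    split=> [|k|k kn]; first by rewrite divpow_0.
      by rewrite -polyCM (dividedS hDd) polyCMn.
    by rewrite (divided_eq0 hDd).
  rewrite derivM derivC mul0r add0r (deriv_expp hDd') expr0 mulr1 mulr1n !mulrA.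
  by rewrite -!polyCM conj_root_vector.
- rewrite derivM derivC mulr0 addr0 dV. exact: (esym (mulrA _ _ _)).
- rewrite [RHS]coef0M V0 mul1r [LHS]coef0M coefC eqxx.
  rewrite coef_sum big_ord_recl /= muln0 mulr1 coefC eqxx divpow_0.
  by rewrite big1 ?addr0 ?mulr1 // => i _; rewrite coefMXn.
Qed.
End Formula.

(** * Specialisation of s and t in a ring *)

Section Eval.
Variables (R : comNzRingType) (n : nat) (s t : R).

Let int_mx : 'M[int]_n.+1 -> 'M[R]_n.+1 := map_mx intr.

Fact comm_s : commr_rmorph int_mx s%:M.
Proof. by move=> X; apply/esym; exact: scalar_mxC. Qed.
(** A scalar matrix commutes with all coefficients, so evaluating there is a ring morphism although
    the coefficients do not commute. *)
Definition eval1 := horner_morph comm_s.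
HB.instance Definition _ := GRing.RMorphism.on eval1.

Fact comm_t : commr_rmorph eval1 t%:M.
Proof. by move=> X; apply/esym; exact: scalar_mxC. Qed.
Definition eval2 := horner_morph comm_t.
HB.instance Definition _ := GRing.RMorphism.on eval2.

Lemma eval2M p q : eval2 (p * q) = eval2 p * eval2 q.
Proof. exact: rmorphM. Qed.

Lemma eval2_prod (rs : seq nat) (P : nat -> {poly {poly 'M[int]_n.+1}}) :
  eval2 (\prod_(r <- rs) P r) = \prod_(r <- rs) eval2 (P r).
Proof. exact: rmorph_prod. Qed.

Lemma eval2C p : eval2 p%:P = eval1 p. Proof. exact: horner_morphC. Qed.
Lemma eval1C X : eval1 X%:P = int_mx X. Proof. exact: horner_morphC. Qed.

Lemma eval1_monomial X k : eval1 (X%:P * 'X^k) = s ^+ k *: map_mx intr X.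
Proof.
rewrite rmorphM rmorphXn /= eval1C /eval1 horner_morphX -[s%:M ^+ k]rmorphXn /=.
by rewrite -mul_mx_scalar.
Qed.

Lemma eval2_monomial p k : eval2 (p%:P * 'X^k) = t ^+ k *: eval1 p.
Proof.
rewrite rmorphM rmorphXn /= eval2C /eval2 horner_morphX -[t%:M ^+ k]rmorphXn /=.
by rewrite -mul_mx_scalar.
Qed.

Lemma eval2_expmx i X k j :
  eval2 (expp n.+1 (monoD i X k) j) = expmx X (i%:~R * s ^+ k * t ^+ j).
Proof.
rewrite rmorph_sum /=; apply: eq_bigr => m _.
rewrite eval2_monomial eval1_monomial map_mxZ !scalerA; congr (_ *: _).
by rewrite rmorphXn /= !exprMn -!exprM mulrC [t ^+ _ * _]mulrC mulrA.
Qed.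

Lemma eval1_expmx X : eval1 (expp n.+1 (divpow X) 1) = expmx X s.
Proof.
by rewrite rmorph_sum /=; apply: eq_bigr => m _; rewrite eval1_monomial mul1n.
Qed.

Lemma eval2_expmxC X :
  eval2 (expp n.+1 (fun m => (divpow X m)%:P) 1) = expmx X t.
Proof.
rewrite rmorph_sum /=; apply: eq_bigr => m _.
by rewrite eval2_monomial eval1C mul1n.
Qed.
End Eval.

Section CommutatorFormula.
Variables (F : rcfType) (l : nat) (Phi : seq 'rV[F]_l).
Hypothesis Phi_root : root_system Phi.
Hypothesis Phi_red : reduced Phi.
Variables (n : nat) (e : 'rV[F]_l -> 'M[int]_n.+1).
Hypothesis Phi_chev : chevalley_module Phi e.

(** The integers are chosen before R, s and t: one generic identity is specialised to all of
    them. *)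
Lemma expmx_commutator g d : g \in Phi -> d \in Phi -> nonprop g d ->
  -1 <= pairing g d -> exists (c dd : nat -> int) (m : nat),
  [/\ forall k, d + g *+ k \notin Phi -> c k = 0,
      string_start Phi g d 0 -> forall k,
        (forall j, (j <= k)%N -> d + g *+ j \in Phi) -> c k = 1 \/ c k = -1,
      forall r, d *+ 2 + g *+ r \notin Phi -> dd r = 0
    & forall (R : comPzRingType) (s t : R),
      expmx (e g) s * expmx (e d) t =
      (\prod_(r <- iota 0 m)
        expmx (e (d *+ 2 + g *+ r)) ((dd r)%:~R * s ^+ r * t ^+ 2)) *
      (\prod_(k <- [:: 3; 2; 1]%N)
        expmx (e (d + g *+ k)) ((c k)%:~R * s ^+ k * t)) *
      expmx (e d) t * expmx (e g) s].
Proof.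
move=> gPhi dPhi gd good.
have [c [c0 cS cN c1]] := string_coefs Phi_root Phi_red Phi_chev gPhi dPhi gd.
have [dd [m [ddN gen]]] :=
  commutator_formula_generic Phi_root Phi_red Phi_chev gPhi dPhi gd good
    c0 cS cN.
have nz (R : comNzRingType) (s t : R) : expmx (e g) s * expmx (e d) t =
    (\prod_(r <- iota 0 m)
        expmx (e (d *+ 2 + g *+ r)) ((dd r)%:~R * s ^+ r * t ^+ 2)) *
    (\prod_(k <- [:: 3; 2; 1]%N)
        expmx (e (d + g *+ k)) ((c k)%:~R * s ^+ k * t)) *
    expmx (e d) t * expmx (e g) s.
  have := congr1 (eval2 s t) gen.
  rewrite 3!eval2M !eval2_prod eval2C eval1_expmx eval2_expmxC => ->.
  congr (_ * _); rewrite -mulrA; congr (_ * _).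
    by apply: eq_bigr => r _; rewrite eval2_expmx.
  transitivity (\prod_(k <- [:: 3; 2; 1; 0]%N)
      expmx (e (d + g *+ k)) ((c k)%:~R * s ^+ k * t)).
    by apply: eq_bigr => k _; rewrite eval2_expmx expr1.
  rewrite !big_cons !big_nil -!mulrA; do 3 congr (_ * _).
  by rewrite c0 mulr0n addr0 mulr1z expr0 !mul1r mulr1.
exists c, dd, m; split=> // R s t.
(* The evaluation morphisms are defined for nontrivial rings; over the zero ring any two matrices
   agree. *)
have [R0|R1] := eqVneq (1 : R) 0.
  apply/matrixP => i j; have triv (x y : R) : x = y.
    by rewrite -[x]mul1r -[y]mul1r R0 !mul0r.
  exact: triv.
pose R' : comNzRingType := HB.pack (GRing.ComPzRing.sort R)
  (GRing.PzSemiRing_isNonZero.Build R R1).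
exact: (nz R' s t).
Qed.
End CommutatorFormula.

(** * Commuting modulo a normal closure *)

Section GroupIdentities.
Variable G : groupType.
Implicit Types x y z g h : G.
Local Open Scope group_scope.

Lemma generated_sub (S T : G -> Prop) : (forall g, S g -> T g) ->
  forall g, Defs.generated S g -> Defs.generated T g.
Proof.
move=> ST g; elim=> [{}g /ST|||]; first exact: generated_in.
- exact: generated_1.
- by move=> *; exact: generated_M.
- by move=> *; exact: generated_V.
Qed.

Lemma commlMl x y z : comml (x * y) z = conjl x (comml y z) * comml x z.
Proof. by rewrite /comml /conjl invMg !mulgA !mulgVK. Qed.

Lemma commlMr x y z : comml x (y * z) = comml x y * conjl y (comml x z).
Proof. by rewrite /comml /conjl invMg !mulgA !mulgVK. Qed.

Lemma commlVl x z : comml x^-1 z = conjl x^-1 (comml x z)^-1.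
Proof. by rewrite /comml /conjl !invMg !invgK !mulgA mulgVK. Qed.

Lemma commlC x z : comml z x = (comml x z)^-1.
Proof. by rewrite /comml !invMg !invgK !mulgA. Qed.

Lemma conjlE x y : conjl x y = comml x y * y.
Proof. by rewrite /conjl /comml mulgVK. Qed.

Section NormalClosure.
Variables (E H : G -> Prop).
Hypothesis E1 : E 1.
Hypothesis EM : forall g h, E g -> E h -> E (g * h).
Hypothesis EV : forall g, E g -> E g^-1.
Let N := normal_closure E H.

Let N1 : N 1. Proof. exact: generated_1. Qed.
Let NM g h : N g -> N h -> N (g * h). Proof. exact: generated_M. Qed.
Let NV g : N g -> N g^-1. Proof. exact: generated_V. Qed.

Lemma normal_closure_conj x g : E x -> N g -> N (conjl x g).
Proof.
move=> Ex; elim=> [{}g [y [z [Ey Hz ->]]]||{}g h _ IHg _ IHh|{}g _ IHg].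
- apply: generated_in; exists (x * y), z; split=> //; first exact: EM.
  by rewrite /conjl invMg !mulgA.
- by rewrite /conjl mulg1 mulgV.
- have -> : conjl x (g * h) = conjl x g * conjl x h.
    by rewrite /conjl !mulgA mulgVK.
  exact: NM.
- have -> : conjl x g^-1 = (conjl x g)^-1.
    by rewrite /conjl !invMg invgK !mulgA.
  exact: NV.
Qed.

Lemma normal_closure_sub h : H h -> N h.
Proof.
move=> Hh; apply: generated_in; exists 1, h; split=> //.
by rewrite /conjl mul1g invg1 mulg1.
Qed.

(** Membership in E is included because [normal_closure_conj] concerns conjugation by elements of
    E. *)
Definition centralizes_mod y g := E g /\ N (comml g y).

Lemma centralizes_mod1 y : centralizes_mod y 1.
Proof. by split=> //; rewrite /comml mul1g invg1 mulg1 mulgV. Qed.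

Lemma centralizes_modM y g h :
  centralizes_mod y g -> centralizes_mod y h -> centralizes_mod y (g * h).
Proof.
move=> [Eg Ng] [Eh Nh]; split; first exact: EM.
by rewrite commlMl; apply: NM => //; exact: normal_closure_conj.
Qed.

Lemma centralizes_modV y g : centralizes_mod y g -> centralizes_mod y g^-1.
Proof.
move=> [Eg Ng]; split; first exact: EV.
by rewrite commlVl; apply: normal_closure_conj; [exact: EV | exact: NV].
Qed.

Lemma centralizes_mod_sym y g :
  E y -> centralizes_mod y g -> centralizes_mod g y.
Proof. by move=> Ey [Eg Ng]; split=> //; rewrite commlC; exact: NV. Qed.

Lemma centralizes_mod_generated y S g :
  (forall h, S h -> centralizes_mod y h) ->
  Defs.generated S g -> centralizes_mod y g.
Proof.
move=> SC; elim=> [{}g /SC //||{}g h _ Cg _ Ch|{}g _ Cg].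
- exact: centralizes_mod1.
- exact: centralizes_modM.
- exact: centralizes_modV.
Qed.

Lemma centralizes_mod_comml p x z :
  E p -> E x -> E z ->
  centralizes_mod z (comml x^-1 p) ->
  centralizes_mod (comml z^-1 p) (comml x^-1 p) ->
  centralizes_mod (comml z^-1 p) x ->
  centralizes_mod (comml x z) p.
Proof.
move=> Ep Ex Ez; set y := comml x^-1 p; set w := comml z^-1 p.
move=> [Ey yz] [_ yw] [_ xw]; split=> //.
have Ew : E w by rewrite /w /comml; do !(apply: EM || apply: EV).
have conj_comml q : conjl p q = q * comml q^-1 p.
  by rewrite /comml /conjl invgK !mulgA mulgV mul1g.
have conjC : conjl p (comml x z) = comml (conjl p x) (conjl p z).
  by rewrite /comml /conjl !invMg !invgK !mulgA !mulgVK.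
have -> : comml p (comml x z) =
    conjl x (comml y (z * w)) * conjl (comml x z) (conjl z (comml x w)).
  rewrite -[comml p _](mulgK (comml x z)) -conjlE conjC !conj_comml -/y -/w.
  by rewrite commlMl (commlMr x) [conjl (comml x z) _]/conjl !mulgA.
apply: NM; apply: normal_closure_conj => //.
- rewrite commlMr; apply: NM => //; exact: normal_closure_conj.
- by rewrite /comml; do !(apply: EM || apply: EV).
- exact: normal_closure_conj.
Qed.
End NormalClosure.
End GroupIdentities.

(** * Centrality of the elementary commutators *)

Lemma ideal_pow (R : comPzRingType) (I : R -> Prop) (x : R) i :
  ideal I -> (0 < i)%N -> I x -> I (x ^+ i).
Proof. by case: i => // i hI _ Ix; rewrite exprSr; exact: (idealM hI). Qed.

Section ChevalleyGroup.
Variables (F : rcfType) (l : nat) (Phi : seq 'rV[F]_l).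
Hypothesis Phi_root : root_system Phi.
Hypothesis Phi_red : reduced Phi.
Variables (n : nat) (e : 'rV[F]_l -> 'M[int]_n.+1).
Hypothesis Phi_chev : chevalley_module Phi e.
Variable R : comPzRingType.
Implicit Types (a b g d : 'rV[F]_l) (s t u v xi : R).

Local Notation x := (xroot e).
Local Notation E := (@absolute_elementary _ _ Phi _ e R).

(** It covers non-roots too, at which the factors of the commutator formula have coefficient 0. *)
Lemma xroot0 a : x a (0 : R) = 1%g.
Proof.
apply: val_inj; rewrite /xroot oppr0 expmx_at0 val_insubd.
by case: ifP.
Qed.

Lemma xrootD a s t : a \in Phi -> (x a s * x a t)%g = x a (s + t).
Proof.
move=> aPhi; apply: glmx_inj; rewrite glmxM !(glmx_xroot Phi_root Phi_chev) //.
apply: expmxD; first exact: (chev_nilpotent Phi_root Phi_chev).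
by move=> m; exact: (chev_admissible Phi_chev).
Qed.

Lemma xrootV a s : a \in Phi -> (x a s)^-1%g = x a (- s).
Proof.
by move=> aPhi; apply: (mulgI (x a s)); rewrite mulgV xrootD // subrr xroot0.
Qed.

Lemma xroot_elementary a s : a \in Phi -> E (x a s).
Proof. by move=> aPhi; apply: generated_in; exists a, s. Qed.

Lemma commutator_formula g d : g \in Phi -> d \in Phi -> nonprop g d ->
  -1 <= pairing g d -> exists (c dd : nat -> int) (m : nat),
  [/\ forall k, d + g *+ k \notin Phi -> c k = 0,
      string_start Phi g d 0 -> forall k,
        (forall j, (j <= k)%N -> d + g *+ j \in Phi) -> c k = 1 \/ c k = -1,
      forall r, d *+ 2 + g *+ r \notin Phi -> dd r = 0
    & forall s t, comml (x g s) (x d t) =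
      ((\big[*%g/1%g]_(r <- iota 0 m)
           x (d *+ 2 + g *+ r)%R ((dd r)%:~R * s ^+ r * t ^+ 2)%R) *
       (\big[*%g/1%g]_(k <- [:: 3; 2; 1]%N)
           x (d + g *+ k)%R ((c k)%:~R * s ^+ k * t)%R))%g].
Proof.
move=> gPhi dPhi gd good.
have [c [dd [m [cN c1 ddN formula]]]] :=
  expmx_commutator Phi_root Phi_red Phi_chev gPhi dPhi gd good.
exists c, dd, m; split=> // s t; rewrite /comml.
apply: (mulIg (x d t)); rewrite mulgVK; apply: (mulIg (x g s)); rewrite mulgVK.
have glmxM' (p q : GL R n.+1) : glmx (p * q)%g = glmx p * glmx q by [].
apply: glmx_inj; rewrite !glmxM' !(glmx_xroot Phi_root Phi_chev) // formula.
have glmx_prod (rs : seq nat) (P : nat -> GL R n.+1) :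
    glmx (\big[*%g/1%g]_(r <- rs) P r) = \prod_(r <- rs) glmx (P r).
  by elim/big_rec2: _ => // r p q _ <-.
have glmx_x0 a (i : int) (xi : R) : (a \notin Phi -> i = 0) ->
    glmx (x a (i%:~R * xi)) = expmx (e a) (i%:~R * xi).
  have [aPhi _|_ ->//] := boolP (a \in Phi).
    exact: (glmx_xroot Phi_root Phi_chev).
  by rewrite mul0r xroot0 glmx1 expmx_at0.
congr (_ * _ * _); rewrite !glmx_prod; congr (_ * _); apply: eq_bigr => k _.
  by rewrite -!mulrA glmx_x0 //; exact: ddN.
by rewrite -!mulrA glmx_x0 //; exact: cN.
Qed.

(** The coefficient c is arbitrary: membership of the parameter in an ideal follows from the
    exponents of s and t alone. *)
Definition root_commutators g d s t : GL R n.+1 -> Prop :=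
  fun y => exists i j (c : R), [/\ (0 < i)%N, (0 < j)%N, g *+ i + d *+ j \in Phi
    & y = x (g *+ i + d *+ j) (c * s ^+ i * t ^+ j)].

(** By [good_pair] the precise formula applies to (g, d) or to (d, g); in the second case the
    commutator is inverted. *)
Lemma commutator_formula_weak g d s t : g \in Phi -> d \in Phi -> nonprop g d ->
  Defs.generated (root_commutators g d s t) (comml (x g s) (x d t)).
Proof.
move=> gPhi dPhi gd.
have good_case a b u v :
    a \in Phi -> b \in Phi -> nonprop a b -> -1 <= pairing a b ->
    Defs.generated (root_commutators a b u v) (comml (x a u) (x b v)).
  move=> aPhi bPhi ab /(commutator_formula aPhi bPhi ab).
  move=> [c [dd [m [cN _ ddN ->]]]].
  have term (i : int) k j :
      (0 < j)%N -> (b *+ j + a *+ k \notin Phi -> i = 0) ->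
      (0 < k)%N || (b *+ j \notin Phi) ->
      Defs.generated (root_commutators a b u v)
        (x (b *+ j + a *+ k) (i%:~R * u ^+ k * v ^+ j)).
    move=> j0 iN k0.
    have [rPhi|/iN ->] := boolP (b *+ j + a *+ k \in Phi); last first.
      by rewrite !mul0r xroot0; exact: generated_1.
    have {}k0 : (0 < k)%N.
      by case: k rPhi k0 {iN} => //; rewrite mulr0n addr0 => ->.
    apply: generated_in; exists k, j, i%:~R; split=> //.
      by rewrite addrC.
    by rewrite addrC.
  have prod (rs : seq nat) (P : nat -> GL R n.+1) :
      (forall r, r \in rs -> Defs.generated (root_commutators a b u v) (P r)) ->
      Defs.generated (root_commutators a b u v) (\big[*%g/1%g]_(r <- rs) P r).
    move=> gP; rewrite big_seq; elim/big_rec: _ => [|r p /gP gr gp].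
      exact: generated_1.
    exact: generated_M.
  apply: generated_M; apply: prod => k kin.
    apply: term => //; first exact: ddN.
    (* 2 b is no root of a reduced system, so the factor with k = 0 is trivial. *)
    apply/orP; right; apply/negP; rewrite -scaler_nat => /(Phi_red bPhi).
    case=> /eqP; rewrite ?(eqr_nat F 2 1) //.
    by rewrite -addr_eq0 natr1 pnatr_eq0.
  have := @term (c k) k 1%N isT; rewrite mulr1n expr1; apply; first exact: cN.
  by move: kin; rewrite !inE; case: k.
have [good|good] := good_pair Phi_root Phi_red gPhi dPhi gd.
  exact: good_case.
rewrite commlC; apply: generated_V.
apply: generated_sub (good_case _ _ t s dPhi gPhi _ good).
  move=> y [i [j [c [i0 j0 rPhi ->]]]]; exists j, i, c; split=> //.
    by rewrite addrC.
  by rewrite [in LHS]addrC mulrAC.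
by rewrite nonpropC.
Qed.

Section Centrality.
Variables A B : R -> Prop.
Hypotheses (A_ideal : ideal A) (B_ideal : ideal B).
Local Notation N := (relative_elementary Phi e (ideal_mul A B)).
Local Notation C := (centralizes_mod E (elementary Phi e (ideal_mul A B))).

Let E1 : E 1%g. Proof. exact: generated_1. Qed.
Let EM p q : E p -> E q -> E (p * q)%g. Proof. exact: generated_M. Qed.
Let EV p : E p -> E (p^-1)%g. Proof. exact: generated_V. Qed.

(** The factors of the commutator have parameters c u^i v^j with i, j > 0, which lie in AB. *)
Lemma xroot_comm_mod a b u v :
  a \in Phi -> b \in Phi -> a + b != 0 -> A u -> B v ->
  C (x b v) (x a u).
Proof.
move=> aPhi bPhi ab0 Au Bv; split; first exact: xroot_elementary.
have [ba|ba] := eqVneq b a.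
  rewrite ba /comml xrootD // addrC -xrootD // mulgK mulgV; exact: generated_1.
have ab : nonprop a b.
  by rewrite /nonprop ba /=; apply: contraNneq ab0 => ->; rewrite subrr.
apply: (normal_closure_sub E1).
apply: generated_sub (commutator_formula_weak u v aPhi bPhi ab).
move=> y [i [j [c [i0 j0 rPhi ->]]]].
exists (a *+ i + b *+ j), (c * u ^+ i * v ^+ j); split=> //.
exists [:: (c * u ^+ i, v ^+ j)]; split; last by rewrite big_seq1.
move=> p; rewrite inE => /eqP -> /=; split; last exact: ideal_pow.
by apply: (idealM A_ideal); exact: ideal_pow.
Qed.

Section RootCommutator.
Variables (a : 'rV[F]_l) (u v : R).
Hypotheses (aPhi : a \in Phi) (Au : A u) (Bv : B v).
Let y := yroot e a u v.
Let NaPhi : - a \in Phi := root_opp Phi_root aPhi.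

Let Ey : E y.
Proof.
rewrite /y /yroot /comml.
by do !(apply: EM || apply: EV); exact: xroot_elementary.
Qed.

Lemma xroot_central_nonprop b xi : b \in Phi -> nonprop a b -> C y (x b xi).
Proof.
move=> bPhi ab; have Nab : nonprop (- a) b by rewrite nonpropNl.
(* By independence of a and b, it is enough that the coefficient j + j' of b is nonzero. *)
have sum_neq0 i i' j j' : (0 < j + j')%N ->
    a *+ i + b *+ j + (- a *+ i' + b *+ j') != 0.
  move=> jj; apply/eqP.
  rewrite addrACA -mulrnDr mulNrn -!scaler_nat -scalerBl addrC.
  move/(nonprop_free Phi_root Phi_red aPhi bPhi ab) => [/eqP].
  by rewrite pnatr_eq0 -leqn0 leqNgt jj.
have genE c i j : (0 < i)%N -> forall I w, ideal I -> I w ->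
    I (c * w ^+ i * xi ^+ j).
  move=> i0 I w hI Iw; rewrite mulrC mulrA; apply: (idealM hI).
  exact: ideal_pow.
have NAu : A (- u) by rewrite -mulN1r; exact: (idealM A_ideal).
have NBv : B (- v) by rewrite -mulN1r; exact: (idealM B_ideal).
have gen1 := commutator_formula_weak (- u) xi aPhi bPhi ab.
have gen2 := commutator_formula_weak (- v) xi NaPhi bPhi Nab.
(* Three pairs must commute: the factors for i a + j b with x_(-a)(v), the same factors with those
   for - i' a + j' b, and the latter with x_a(u). *)
apply: (centralizes_mod_comml EM EV (x := x a u) (z := x (- a) v));
  rewrite ?(xrootV u aPhi) ?(xrootV v NaPhi); try exact: xroot_elementary.
- apply: (centralizes_mod_generated E1 EM EV _ gen1).
  move=> h [i [j [c [i0 j0 rPhi ->]]]].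
  apply: xroot_comm_mod => //; last exact: genE.
  by have := sum_neq0 i 1%N j 0%N; rewrite addn0 mulr0n addr0 mulr1n => ->.
- apply: (centralizes_mod_generated E1 EM EV _ gen1).
  move=> h [i [j [c [i0 j0 rPhi ->]]]]; apply: centralizes_mod_sym.
    exact: xroot_elementary.
  apply: (centralizes_mod_generated E1 EM EV _ gen2).
  move=> h' [i' [j' [c' [i0' j0' rPhi' ->]]]]; apply: centralizes_mod_sym.
    exact: xroot_elementary.
  apply: xroot_comm_mod => //; try exact: genE.
  by rewrite sum_neq0 // addn_gt0 j0.
- apply: centralizes_mod_sym; first exact: xroot_elementary.
  apply: (centralizes_mod_generated E1 EM EV _ gen2).
  move=> h' [i' [j' [c' [i0' j0' rPhi' ->]]]]; apply: centralizes_mod_sym.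
    exact: xroot_elementary.
  apply: xroot_comm_mod => //; last exact: genE.
  by have := sum_neq0 1%N i' 0%N j'; rewrite add0n mulr0n addr0 mulr1n => ->.
Qed.

Hypothesis Phi_irr : irreducible Phi.
Hypothesis l_ge2 : (2 <= l)%N.

Lemma xroot_central_prop b xi : b \in Phi -> b = a \/ b = - a -> C y (x b xi).
Proof.
move=> bPhi ba.
have C_nonprop b' zeta : b' \in Phi -> nonprop b b' -> C y (x b' zeta).
  move=> b'Phi bb'; apply: xroot_central_nonprop => //.
  by case: ba bb' => ->; rewrite ?nonpropNl.
have [g [d [k [[gPhi dPhi gd good] /andP[k0 k3] bE dgk sp0]]]] :=
  root_decomposition Phi_root Phi_red Phi_irr l_ge2 bPhi.
have [c [dd [m [cN c1 ddN formula]]]] := commutator_formula gPhi dPhi gd good.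
(* Apart from d + k g = b itself, no root in the formula is proportional to b: compare coordinates
   in d and g. *)
have nonprop_combo2 j i : (0 < j)%N || (0 < i)%N -> (j, i) != (1, k)%N ->
    nonprop b (d *+ j + g *+ i).
  move=> ji0 jik; rewrite /nonprop bE -!scaler_nat -{2 4}[d]scale1r.
  have free := nonprop_free Phi_root Phi_red gPhi dPhi gd.
  apply/andP; split; apply/eqP => /eqP.
    rewrite -subr_eq0 opprD addrACA -!scalerBl => /eqP/free[/eqP + /eqP].
    rewrite !subr_eq0 eqr_nat (eqr_nat F j 1) => /eqP j1 /eqP ik.
    by rewrite j1 ik eqxx in jik.
  rewrite -addr_eq0 addrACA -!scalerDl => /eqP/free[/eqP + _].
  by rewrite natr1 pnatr_eq0.
have Cprod (rs : seq nat) (P : nat -> GL R n.+1) :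
    (forall r, r \in rs -> C y (P r)) -> C y (\big[*%g/1%g]_(r <- rs) P r).
  move=> CP; rewrite big_seq; elim/big_rec: _ => [|r p /CP Cr Cp].
    exact: centralizes_mod1.
  exact: (centralizes_modM EM).
have Cterm (i : int) j r w : (0 < j)%N || (0 < r)%N -> (j, r) != (1, k)%N ->
    (d *+ j + g *+ r \notin Phi -> i = 0) ->
    C y (x (d *+ j + g *+ r) (i%:~R * w)).
  move=> jr0 jrk iN; have [rPhi|/iN ->] := boolP (d *+ j + g *+ r \in Phi).
    by apply: C_nonprop => //; exact: nonprop_combo2.
  by rewrite mul0r xroot0; exact: centralizes_mod1.
(* c k = +-1 squares to 1, so the k-th factor has parameter exactly xi. *)
pose zeta : R := (c k)%:~R * xi.
have czeta : (c k)%:~R * 1 ^+ k * zeta = xi.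
  rewrite expr1n mulr1 /zeta mulrA -intrM.
  by case: (c1 sp0 k dgk) => ->; rewrite ?mulrNN mulr1 mul1r.
set X := \big[*%g/1%g]_(r <- iota 0 m)
  x (d *+ 2 + g *+ r)%R ((dd r)%:~R * 1 ^+ r * zeta ^+ 2)%R.
have CX : C y X.
  apply: Cprod => r _; rewrite -mulrA; apply: Cterm => //; exact: ddN.
have CE : C y (comml (x g 1) (x d zeta)).
  have Cg : C y (x g 1).
    apply: C_nonprop => //.
    by have := nonprop_combo2 0%N 1%N isT isT; rewrite mulr0n add0r.
  have Cd : C y (x d zeta).
    apply: C_nonprop => //.
    have := nonprop_combo2 1%N 0%N isT; rewrite mulr0n addr0; apply.
    by rewrite xpair_eqE eqxx eq_sym -lt0n.
  apply: (centralizes_modM EM _ (centralizes_modV EM EV Cd)).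
  apply: (centralizes_modM EM _ (centralizes_modV EM EV Cg)).
  exact: (centralizes_modM EM Cg Cd).
have CT j : (0 < j)%N -> j != k ->
    C y (x (d + g *+ j) ((c j)%:~R * 1 ^+ j * zeta)).
  move=> j0 jk.
  have := @Cterm (c j) 1%N j (1 ^+ j * zeta); rewrite mulr1n mulrA.
  by apply=> //; exact: cN.
have CM := centralizes_modM EM; have CV := centralizes_modV EM EV.
set T := fun j => x (d + g *+ j) ((c j)%:~R * 1 ^+ j * zeta).
have TE : T k = x b xi by rewrite /T czeta bE.
set T1 := T 1%N; set T2 := T 2%N; set T3 := T 3%N.
have prodE : (X^-1 * comml (x g 1) (x d zeta) = T3 * (T2 * T1))%g.
  by rewrite formula mulKg !big_cons big_nil mulg1.
have CT321 : C y (T3 * (T2 * T1))%g.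
  by rewrite -prodE; apply: (CM) => //; exact: (CV).
rewrite -TE.
(* x_b(xi) is one of T1, T2, T3; the product T3 T2 T1 is solved for it, the other two being already
   known to commute with y. *)
have : k \in [:: 1; 2; 3]%N by rewrite !inE; move: k0 k3; clear; lia.
rewrite !inE => /or3P[] /eqP kE; rewrite {1}kE -?/T1 -?/T2 -?/T3.
- have -> : T1 = ((T3 * T2)^-1 * (T3 * (T2 * T1)))%g.
    by rewrite (mulgA T3) mulKg.
  by apply: (CM) => //; apply: (CV); apply: (CM); apply: (CT); rewrite ?kE.
- have -> : T2 = (T3^-1 * (T3 * (T2 * T1)) * T1^-1)%g by rewrite mulKg mulgK.
  by apply: (CM); [apply: (CM) => //|]; apply: (CV); apply: (CT); rewrite ?kE.
- have -> : T3 = (T3 * (T2 * T1) * (T2 * T1)^-1)%g by rewrite mulgK.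
  by apply: (CM) => //; apply: (CV); apply: (CM); apply: (CT); rewrite ?kE.
Qed.

Lemma elementary_central h : E h -> C y h.
Proof.
apply: (centralizes_mod_generated E1 EM EV) => _ [b [xi [bPhi _ ->]]].
have [ab|/nandP[]] := boolP (nonprop a b); first exact: xroot_central_nonprop.
  by rewrite negbK => /eqP ->; apply: xroot_central_prop => //; left.
by rewrite negbK => /eqP ->; apply: xroot_central_prop => //; right.
Qed.

Lemma yroot_conj_congr h : E h -> congr_mod N (conjl h y) y.
Proof.
move=> Eh; have [_ Nhy] := elementary_central Eh; rewrite /congr_mod.
have -> : ((conjl h y)^-1 * y)%g = conjl (y^-1)%g ((comml h y)^-1)%g.
  by rewrite conjlE /conjl invMg invgK.
apply: (normal_closure_conj EM); first exact: EV.
exact: generated_V.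
Qed.
End RootCommutator.
End Centrality.
End ChevalleyGroup.

Theorem theorem2 (F : rcfType) (l : nat) (Phi : seq 'rV[F]_l)
    (n : nat) (e : 'rV[F]_l -> 'M[int]_n)
    (R : comPzRingType) (A B : R -> Prop)
    (Phi_root : root_system Phi) (Phi_red : reduced Phi)
    (Phi_irr : irreducible Phi) (l_ge2 : (2 <= l)%N)
    (Phi_chev : chevalley_module Phi e)
    (A_ideal : ideal A) (B_ideal : ideal B)
    (hyp_C2_G2 : type_C2 Phi \/ type_G2 Phi ->
       ~ has_residue_field_of_two_elements R)
    (hyp_C : type_C Phi ->
       forall c : R, exists r s : R, c = c ^+ 2 * r + 2 * c * s)
    (alpha : 'rV[F]_l) (alpha_root : alpha \in Phi)
    (a b : R) (aA : A a) (bB : B b)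
    (x : GL R n) (xE : absolute_elementary Phi e x) :
  congr_mod (relative_elementary Phi e (ideal_mul A B))
    (conjl x (yroot e alpha a b)) (yroot e alpha a b).
Proof.
(* For n = 0 the nonzero root vector [e alpha] would be an empty matrix. *)
case: n e Phi_chev x xE => [|n'] e' chev x xE; last exact: yroot_conj_congr.
by have /eqP[] := chev_neq0 chev alpha_root; rewrite thinmx0.
Qed.
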